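(* Let $F$ be an $R$-module of symmetric type $\Phi$ with finitely many submodules, let $\phi\le\Phi$ be a type such that $(\Phi,\phi)$ is a symmetric couple, and let $G=\mathrm{Aut}_R(F)$. Then there exists a collection of pairwise non-equivalent irreducible $G$-representations $\{\mathcal U_\lambda\}_{\lambda\le\phi}$ (over $\mathbb Q$) such that: (1) $\mathcal F_\phi\simeq\bigoplus_{\lambda\le\phi}\mathcal U_\lambda$. (2) For every $\lambda,\nu\le\phi$, $\langle\mathcal U_\lambda,\mathcal F_\nu\rangle=|\{\lambda\hookrightarrow\nu\}|$; that is, the multiplicity of $\mathcal U_\lambda$ in $\mathcal F_\nu$ is the number of non-equivalent embeddings of a module of type $\lambda$ in a module of type $\nu$. In particular $\mathcal U_\lambda$ appears in $\mathcal F_\lambda$ with multiplicity one and does not appear in $\mathcal F_\nu$ unless $\lambda\le\nu$.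
   Context: Let $R$ be a ring; modules are finitely generated left $R$-modules. The type $\tau(x)$ of a module $x$ is its isomorphism class; $\lambda\le\mu$ means that a module of type $\mu$ has a submodule of type $\lambda$. Two injections $i:x\hookrightarrow y$ and $i':x'\hookrightarrow y'$ are equivalent if there are isomorphisms $x\to x'$, $y\to y'$ making the square with $i,i'$ commute; $\{\lambda\hookrightarrow\nu\}$ is the set of equivalence classes of injections from a module of type $\lambda$ into a module of type $\nu$. A type $\phi$ is symmetric if for all modules $f,f'$ of type $\phi$, all submodules $x\subseteq f$, $x'\subseteq f'$ and every isomorphism $h:x\to x'$, there is an isomorphism $f\to f'$ extending $h$. For symmetric types $\phi\le\Phi$, $(\Phi,\phi)$ is a symmetric couple if for every module $F$ of type $\Phi$, every $f\subseteq F$ of type $\phi$ and every $\lambda\le\phi$: (i) there is $f'\subseteq F$ with $\tau(f')=\phi$ and $\tau(f\cap f')=\lambda$; (ii) for every $x\subseteq F$ with $\tau(x)\le\phi$, the square formed by $x\cap f$, $x$, $f$, $x+f$ is a pushout, i.e. $x+f\simeq (x\oplus f)/(x\cap f)$ (this holds automatically for modules). For a type $\lambda$, $X_\lambda$ is the set of submodules of $F$ of type $\lambda$, and $\mathcal F_\lambda$ is the space of $\mathbb Q$-valued functions on $X_\lambda$ with $G$-action $[gf](x)=f(g^{-1}x)$. $\langle\mathcal U,\mathcal F\rangle$ denotes the multiplicity of the irreducible representation $\mathcal U$ in $\mathcal F$. *)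

(* Defs.v *)
From HB Require Import structures.
From mathcomp Require Import all_boot all_order all_algebra.
From mathcomp Require Import boolp classical_sets functions cardinality.

Set Implicit Arguments.
Unset Strict Implicit.
Unset Printing Implicit Defensive.

Import GRing.Theory.
Local Open Scope classical_set_scope.
Local Open Scope ring_scope.

Section Submodules.
Variables (R : pzRingType) (M : lmodType R).

(* Not the library's submodClosed M, nor a record over {pred M}: their universe
   is too large for the functions on a set of submodules to form an lmodType. *)
Record submod : Type := Submod {
  submod_fun : M -> bool;
  submod_funP : @submod_closed R M submod_fun }.

Definition submod_pred (x : submod) : {pred M} := submod_fun x.
Coercion submod_pred : submod >-> pred_sort.

HB.instance Definition _ (x : submod) :=
  GRing.isSubmodClosed.Build R M (submod_pred x) (submod_funP x).

Record sub_carrier (x : submod) : Type :=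
  SubCarrier { sub_val : M; sub_valP : sub_val \in x }.

HB.instance Definition _ (x : submod) := [isSub for @sub_val x].
HB.instance Definition _ (x : submod) := [Choice of sub_carrier x by <:].
HB.instance Definition _ (x : submod) :=
  [SubChoice_isSubLmodule of sub_carrier x by <:].

Definition submodule (x : submod) : lmodType R := sub_carrier x.

Lemma submod_eqP (x y : submod) : x =i y <-> x = y.
Proof.
split=> [|-> //]; case: x y => [A cA] [B cB] exy.
have eAB : A = B by apply/funext => u; apply: exy.
by case: _ / eAB in cB exy *; rewrite (Prop_irrelevance cA cB).
Qed.

Lemma submodI_closed (x y : submod) :
  submod_closed [pred u : M | (u \in x) && (u \in y)].
Proof.
split=> [|a u v]; rewrite !inE ?rpred0 //.
by move=> /andP[xu yu] /andP[xv yv]; rewrite !rpredD ?rpredZ.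
Qed.

Definition submodI (x y : submod) : submod :=
  Submod (submodI_closed x y).

Lemma submodD_closed (x y : submod) :
  submod_closed
    [pred u : M | `[< exists v w, [/\ v \in x, w \in y & u = v + w] >]].
Proof.
split=> [|a u1 u2]; rewrite !inE.
  by exists 0, 0; rewrite !rpred0 addr0.
move=> [v1 [w1 [xv1 yw1 ->]]] [v2 [w2 [xv2 yw2 ->]]].
exists (a *: v1 + v2), (a *: w1 + w2).
by rewrite !rpredD ?rpredZ // scalerDr addrACA.
Qed.

Definition submodD (x y : submod) : submod :=
  Submod (submodD_closed x y).

Section Inclusion.
Variables (x y : submod) (sxy : {subset x <= y}).

Definition incl_fun (u : submodule x) : submodule y :=
  SubCarrier (sxy (valP u)).

Lemma incl_linear : linear incl_fun.
Proof. by move=> a u v; apply: val_inj. Qed.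

HB.instance Definition _ :=
  GRing.isLinear.Build R (submodule x) (submodule y) *:%R incl_fun incl_linear.

Definition incl : {linear submodule x -> submodule y} := incl_fun.
End Inclusion.

Lemma submodIl (x y : submod) : {subset submodI x y <= x}.
Proof. by move=> u /andP[]. Qed.

Lemma submodIr (x y : submod) : {subset submodI x y <= y}.
Proof. by move=> u /andP[]. Qed.

Lemma submodDl (x y : submod) : {subset x <= submodD x y}.
Proof. by move=> u xu; apply/asboolP; exists u, 0; rewrite rpred0 addr0. Qed.

Lemma submodDr (x y : submod) : {subset y <= submodD x y}.
Proof. by move=> u yu; apply/asboolP; exists 0, u; rewrite rpred0 add0r. Qed.

End Submodules.

Definition finitely_generated (R : pzRingType) (M : lmodType R) : Prop :=
  exists (n : nat) (v : 'I_n -> M),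
    forall u : M, exists c : 'I_n -> R, u = \sum_(i < n) c i *: v i.

Section Types.
Variable R : pzRingType.
Implicit Types M N : lmodType R.

Definition isomorphic M N : Prop := exists h : {linear M -> N}, bijective h.

(* The type of M, as the class of all modules isomorphic to M; two modules have
   the same type iff they are isomorphic. *)
Record mtype := MType {
  mtype_class : lmodType R -> Prop;
  mtypeP : exists M, mtype_class = isomorphic M }.

Definition tau M : mtype := MType (ex_intro _ M erefl).

Implicit Types l m : mtype.

Definition le_type l m : Prop :=
  exists M (x : submod M), tau M = m /\ tau (submodule x) = l.

Definition symmetric_type l : Prop :=
  forall f f' : lmodType R, tau f = l -> tau f' = l ->
  forall (x : submod f) (x' : submod f')
    (h : {linear submodule x -> submodule x'}), bijective h ->
  exists k : {linear f -> f'},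
    bijective k /\ forall u : submodule x, k (val u) = val (h u).

Definition is_pushout (A B C D : lmodType R)
    (f : {linear A -> B}) (g : {linear A -> C})
    (i : {linear B -> D}) (j : {linear C -> D}) : Prop :=
  (forall a, i (f a) = j (g a)) /\
  forall (N : lmodType R) (p : {linear B -> N}) (q : {linear C -> N}),
    (forall a, p (f a) = q (g a)) ->
    (exists r : {linear D -> N},
       (forall b, r (i b) = p b) /\ (forall c, r (j c) = q c)) /\
    (forall r r' : {linear D -> N},
       (forall b, r (i b) = p b) -> (forall c, r (j c) = q c) ->
       (forall b, r' (i b) = p b) -> (forall c, r' (j c) = q c) -> r =1 r').

Definition symmetric_couple (Phi phi : mtype) : Prop :=
  [/\ symmetric_type Phi, symmetric_type phi, le_type phi Phi &
    forall F : lmodType R, tau F = Phi ->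
    forall f : submod F, tau (submodule f) = phi ->
      (forall l, le_type l phi ->
         exists f' : submod F,
           tau (submodule f') = phi /\ tau (submodule (submodI f f')) = l) /\
      (forall x : submod F, le_type (tau (submodule x)) phi ->
         is_pushout (incl (@submodIl _ _ x f)) (incl (@submodIr _ _ x f))
                    (incl (@submodDl _ _ x f)) (incl (@submodDr _ _ x f)))].

Record embedding l m := Embedding {
  emb_src : lmodType R;
  emb_tgt : lmodType R;
  emb_map : {linear emb_src -> emb_tgt};
  emb_srcP : tau emb_src = l;
  emb_tgtP : tau emb_tgt = m;
  emb_inj : injective emb_map }.

Definition emb_equiv l m (e e' : embedding l m) : Prop :=
  exists (a : {linear emb_src e -> emb_src e'})
         (b : {linear emb_tgt e -> emb_tgt e'}),
    [/\ bijective a, bijective b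
      & forall u, b (emb_map e u) = emb_map e' (a u)].

Definition emb_class l m : Type :=
  {C : embedding l m -> Prop | exists e, C = emb_equiv e}.

Definition has_card (T : Type) (n : nat) : Prop :=
  exists b : 'I_n -> T, bijective b.

End Types.

Section Automorphisms.
Variables (R : pzRingType) (M : lmodType R).

Definition is_aut : pred (M -> M) := fun f => `[< linear f /\ bijective f >].

Record aut := Aut { aut_fun : M -> M; autP : is_aut aut_fun }.

HB.instance Definition _ := [isSub for aut_fun].
HB.instance Definition _ := [Choice of aut by <:].

Lemma aut_linear (g : aut) : linear (aut_fun g).
Proof. by case/asboolP: (autP g). Qed.

HB.instance Definition _ (g : aut) :=
  GRing.isLinear.Build R M M *:%R (aut_fun g) (aut_linear g).

Lemma aut_bij (g : aut) : bijective (aut_fun g).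
Proof. by case/asboolP: (autP g). Qed.

Lemma aut1_subproof : is_aut id.
Proof. by apply/asboolP; split=> //; exists id. Qed.

Definition aut1 : aut := Aut aut1_subproof.

Lemma autM_subproof (g h : aut) : is_aut (aut_fun g \o aut_fun h).
Proof.
apply/asboolP; split; last exact: bij_comp (aut_bij g) (aut_bij h).
by move=> a u v /=; rewrite !linearP.
Qed.

Definition autM (g h : aut) : aut := Aut (autM_subproof g h).

Lemma autV_subproof (g : aut) :
  exists k : aut, cancel (aut_fun g) (aut_fun k)
               /\ cancel (aut_fun k) (aut_fun g).
Proof.
have [k gK kK] := aut_bij g.
have kP : is_aut k.
  apply/asboolP; split; last by exists (aut_fun g).
  by move=> a u v; apply: (can_inj gK); rewrite kK aut_linear !kK.
by exists (Aut kP).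
Qed.

Definition autV (g : aut) : aut := projT1 (cid (autV_subproof g)).

Lemma aut_funK (g : aut) : cancel (aut_fun g) (aut_fun (autV g)).
Proof. by rewrite /autV; case: cid => k []. Qed.

Lemma autV_funK (g : aut) : cancel (aut_fun (autV g)) (aut_fun g).
Proof. by rewrite /autV; case: cid => k []. Qed.

Lemma autMA : associative autM.
Proof. by move=> f g h; apply: val_inj. Qed.

Lemma aut1M : left_id aut1 autM.
Proof. by move=> g; apply: val_inj. Qed.

Lemma autM1 : right_id aut1 autM.
Proof. by move=> g; apply: val_inj. Qed.

Lemma autVM : left_inverse aut1 autV autM.
Proof. by move=> g; apply: val_inj; apply/funext => u; apply: aut_funK. Qed.

Lemma autMV : right_inverse aut1 autV autM.
Proof. by move=> g; apply: val_inj; apply/funext => u; apply: autV_funK. Qed.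

HB.instance Definition _ := isGroup.Build aut autMA aut1M autM1 autVM autMV.

Lemma aut_im_closed (g : aut) (x : submod M) :
  submod_closed [pred v : M | `[< exists2 u, u \in x & aut_fun g u = v >]].
Proof.
split=> [|a v1 v2]; rewrite !inE.
  by exists 0; rewrite ?rpred0 ?linear0.
move=> [u1 xu1 <-] [u2 xu2 <-].
by exists (a *: u1 + u2); rewrite ?linearP // rpredD ?rpredZ.
Qed.

Definition aut_im (g : aut) (x : submod M) : submod M :=
  Submod (aut_im_closed g x).

End Automorphisms.

Lemma tau_eqP (R : pzRingType) (M N : lmodType R) :
  tau M = tau N <-> isomorphic M N.
Proof.
split=> [[/(congr1 (@^~ N)) MN]|[h [k hK kK]]].
  by rewrite MN; exists idfun; exists idfun.
have linh a u v : h (a *: u + v) = a *: h u + h v by rewrite linearP.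
have link : linear k by move=> a u v; apply: (can_inj hK); rewrite linh !kK.
pose kl : {linear N -> M} :=
  HB.pack_for {linear N -> M} k (GRing.isLinear.Build R N M *:%R k link).
have eqC : isomorphic M = isomorphic N.
  apply/funext => P; apply/propext; split=> [[f bf]|[f bf]].
    by exists (f \o kl); apply: bij_comp bf _; exists h.
  by exists (f \o h); apply: bij_comp bf _; exists k.
have mtype_eq A B pA pB : A = B -> @MType R A pA = @MType R B pB.
  by move=> eAB; case: _ / eAB in pB *; congr MType; apply: Prop_irrelevance.
exact: mtype_eq.
Qed.

Lemma tau_aut_im (R : pzRingType) (M : lmodType R) (g : aut M)
  (x : submod M) : tau (submodule (aut_im g x)) = tau (submodule x).
Proof.
symmetry; apply/tau_eqP.
have gxP (u : submodule x) : aut_fun g (val u) \in aut_im g x.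
  by apply/asboolP; exists (val u) => //; apply: valP.
pose f (u : submodule x) : submodule (aut_im g x) := SubCarrier (gxP u).
have linf : linear f.
  by move=> a u v; apply: val_inj; rewrite /= aut_linear.
have kP (v : submodule (aut_im g x)) : aut_fun (autV g) (val v) \in x.
  by have /asboolP[u xu <-] := valP v; rewrite aut_funK.
exists (HB.pack_for {linear submodule x -> submodule (aut_im g x)} f
          (GRing.isLinear.Build R _ _ *:%R f linf)).
exists (fun v => SubCarrier (kP v)) => u; apply: val_inj => /=.
  exact: aut_funK.
exact: autV_funK.
Qed.

Section Representations.
Variable G : groupType.

Record rep := Rep {
  rep_space :> lmodType rat;
  rep_act : G -> {linear rep_space -> rep_space};
  rep_act1 : forall v, rep_act 1%g v = v;
  rep_actM : forall g h v, rep_act (g * h)%g v = rep_act g (rep_act h v) }.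

Arguments rep_act {r} g.

Definition rep_iso (V W : rep) : Prop :=
  exists f : {linear V -> W},
    bijective f /\ forall g v, f (rep_act g v) = rep_act g (f v).

Definition irreducible (V : rep) : Prop :=
  (exists v : V, v <> 0) /\
  forall S : submod V,
    (forall g v, v \in S -> rep_act g v \in S) ->
    (forall v, v \in S -> v = 0) \/ (forall v, v \in S).

Definition rep_zero : rep :=
  @Rep 'rV[rat]_0 (fun _ => idfun) (fun _ => erefl) (fun _ _ _ => erefl).

Section DirectSum.
Variables V W : rep.

Definition dsum_fun (g : G) (p : (V * W)%type) : (V * W)%type :=
  (rep_act g p.1, rep_act g p.2).

Lemma dsum_linear g : linear (dsum_fun g).
Proof. by move=> a p q; rewrite /dsum_fun /= !linearP. Qed.

HB.instance Definition _ g :=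
  GRing.isLinear.Build rat (V * W)%type (V * W)%type *:%R (dsum_fun g)
    (dsum_linear g).

Lemma dsum_act1 p : dsum_fun 1%g p = p.
Proof. by case: p => v w; rewrite /dsum_fun /= !rep_act1. Qed.

Lemma dsum_actM g h p : dsum_fun (g * h)%g p = dsum_fun g (dsum_fun h p).
Proof. by rewrite /dsum_fun /= !rep_actM. Qed.

Definition rep_dsum : rep := @Rep (V * W)%type dsum_fun dsum_act1 dsum_actM.
End DirectSum.

Definition rep_bigsum (Vs : seq rep) : rep := foldr rep_dsum rep_zero Vs.

(* <U, V> = m for U irreducible: in a decomposition of V as a finite direct sum
   of irreducibles, exactly m summands are equivalent to U.  By Krull-Schmidt m
   does not depend on the decomposition; over rat it may differ from
   dim Hom_G(U, V). *)
Definition multiplicity (U V : rep) (m : nat) : Prop :=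
  exists Vs : seq rep,
    [/\ forall i, (i < size Vs)%N -> irreducible (nth rep_zero Vs i),
        rep_iso V (rep_bigsum Vs)
      & count (fun W => `[< rep_iso U W >]) Vs = m].

End Representations.

Section FunctionSpaces.
Variables (R : pzRingType) (F : lmodType R) (l : mtype R).

Definition submods_of_type : Type :=
  {x : submod F | tau (submodule x) = l}.

Definition aut_act_submod (g : aut F) (x : submods_of_type) : submods_of_type :=
  exist _ (aut_im g (projT1 x)) (etrans (tau_aut_im g (projT1 x)) (projT2 x)).

Definition fun_space : lmodType rat :=
  GRing.Lmodule.clone rat (submods_of_type -> rat^o) _.

Definition fun_act (g : aut F) (f : fun_space) : fun_space :=
  fun x => f (aut_act_submod g^-1%g x).

Lemma fun_act_linear g : linear (fun_act g).
Proof. by []. Qed.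

HB.instance Definition _ g :=
  GRing.isLinear.Build rat fun_space fun_space *:%R (fun_act g)
    (fun_act_linear g).

Lemma fun_act1 f : fun_act 1%g f = f.
Proof.
apply/funext => -[x xl]; rewrite /fun_act invg1; congr f.
apply: eq_exist; apply/submod_eqP => v; apply/asboolP/idP => [[u xu <-] //|xv].
by exists v.
Qed.

Lemma fun_actM g h f : fun_act (g * h)%g f = fun_act g (fun_act h f).
Proof.
apply/funext => -[x xl]; rewrite /fun_act invgM; congr f.
apply: eq_exist; apply/submod_eqP => v; apply/asboolP/asboolP.
  case=> u xu <-; exists (aut_fun g^-1%g u) => //.
  by apply/asboolP; exists u.
by case=> _ /asboolP[u xu <-] <-; exists u.
Qed.

Definition fun_rep : rep (aut F) :=
  @Rep (aut F) fun_space fun_act fun_act1 fun_actM.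

End FunctionSpaces.

(* Main.v *)
Require Import Defs.
From HB Require Import structures.
From mathcomp Require Import all_boot all_order all_algebra.
From mathcomp Require Import boolp classical_sets functions cardinality.

Set Implicit Arguments.
Unset Strict Implicit.
Unset Printing Implicit Defensive.

Import Order.TTheory GRing.Theory Num.Theory.
Local Open Scope ring_scope.
Arguments rep_act {G r} g.

(** The group [G = aut F] permutes the finite set of submodules of [F], and for [n]
    below [tau F] the space [fun_rep F n] consists of the functions on one orbit:
    since [tau F] is symmetric, submodules of the same type are conjugate.  A submodule [k] below
    two submodules [f], [f'] of type [phi] can be fixed pointwise while [f] is
    moved to [f'] ([homog_sub]); when [k <= x <= f], the submodule [f] can be
    moved, fixing [k] pointwise, so as to meet [x] exactly in [k]
    ([meet_all_sub]); and an automorphism that fixes [w :&: x] pointwise glues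
    with the identity of [x] ([glue_aut]).  These three facts are packaged in the
    structure [couple_lattice], on which the rest of the argument takes place.

    List the types below [phi] as t_0, ..., t_(k-1) by increasing number of
    submodules.  Let V_i be the subspace of F_phi spanned by the functions
    f |-> [x <= f], for x of type t_j with j < i.  This is an increasing invariant
    filtration from 0 to F_phi, and U_i is the orthogonal complement of V_i in
    V_(i+1) (the image of [layer i]).  Hence F_phi is the orthogonal sum of the
    U_i ([sum_layer]), and it remains to compute the homomorphisms from F_nu to
    U_i.

    Fix x0 of type nu <= phi.  An invariant kernel T on X_nu * X_phi is determined
    by its values on the pairs (x0, f'), which only depend on the meet of f' and x0
    ([normal_position]).  The kernels E_y ([emb_ker]) which count the submodules of
    x and f' that sit in x as y sits in x0, for y up to the stabilizer of x0, are
    linearly independent by Moebius inversion ([emb_ker_free]).  The key point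
    ([inc_mx_eval], [emb_ker_span]) is that those with y of type t_j, j < i, span
    the kernels with rows in V_i: such a kernel is a sum over j < i of products
    S_j B_j with S_j invariant and B_j the incidence kernel of t_j, and the value
    of S_j B_j at a pair with meet z is a sum over w <= f of a function of the meet
    of w and z, whose Moebius transform is supported on the submodules of w.
    So the dimension of Hom(F_nu, U_i) is the number of classes of y of type t_i
    ([hom_space_orb_proj_dim]), that is, of embeddings of t_i in nu
    ([emb_class_card]).

    For nu = phi this number is 1 because [phi] is symmetric, so every
    endomorphism of U_i is a rational scalar and there is no nonzero homomorphism
    between distinct U_i: the U_i are irreducible and pairwise inequivalent.
    Since End(U_i) is the field of rationals, the multiplicity of U_i in F_nu,
    counted in a decomposition into irreducibles, is the dimension of
    Hom(F_nu, U_i) ([im_rep_multiplicity]). *)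

(** * Orthogonal projections over the rationals *)
Lemma mulmx_tr_eq0 m n (A : 'M[rat]_(m, n)) : A *m A^T = 0 -> A = 0.
Proof.
move=> AA0; apply/matrixP=> i j; rewrite mxE.
have /matrixP/(_ i i) := AA0; rewrite !mxE => /eqP.
rewrite psumr_eq0 => [|k _]; last by rewrite mxE -expr2 sqr_ge0.
by move=> /allP/(_ j (mem_index_enum j)); rewrite mxE -expr2 sqrf_eq0 => /eqP.
Qed.

Lemma tr_mulmx_eq0 m n (A : 'M[rat]_(m, n)) : A^T *m A = 0 -> A = 0.
Proof.
move=> AA0; apply: trmx_inj; rewrite trmx0; apply: mulmx_tr_eq0.
by rewrite trmxK.
Qed.

(** A subspace given by a predicate on a finite-dimensional space is detachable:
    take one of maximal dimension among the detachable subspaces it contains. *)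
Lemma submod_vspace (K : fieldType) (V : vectType K) (S : submod V) :
  exists U : {vspace V}, forall v, (v \in U) = (v \in S).
Proof.
pose P d := `[< exists U : {vspace V}, \dim U = d /\ {subset U <= S} >].
have exP : exists d, P d.
  exists 0%N; apply/asboolP; exists 0%VS; split; first exact: dimv0.
  move=> v; rewrite memv0 => /eqP ->.
  exact: rpred0.
have leP d : P d -> (d <= \dim {:V})%N.
  by move=> /asboolP[U [<- _]]; apply: dimvS (subvf U).
case: (ex_maxnP exP leP) => d /asboolP[U [dU US]] maxd.
exists U => v; apply/idP/idP => [/US //|Sv]; apply: contraT => Uv.
have : P (\dim (U + <[v]>)).
  apply/asboolP; exists (U + <[v]>)%VS; split=> // w /memv_addP[u uU [z zv ->]].
  have /vlineP[c ->] := zv.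
  by apply: rpredD; [apply: US|apply: rpredZ].
move=> /maxd; rewrite -dU => le_dim.
have /eqP eU : U == (U + <[v]>)%VS by rewrite eqEdim addvSl.
by case/negP: Uv; rewrite eU (subvP (addvSr _ _)) ?memv_line.
Qed.

(** Subspaces of ['rV_N] are handled through the symmetric idempotent matrix which
    fixes exactly their elements; here it is B^T (B B^T)^-1 B, for B a basis. *)
Lemma orth_projection N (S : submod 'rV[rat]_N) :
  exists P : 'M[rat]_N,
    [/\ P^T = P, P *m P = P & forall v, (v \in S) = (v *m P == v)].
Proof.
have [U US] := submod_vspace S.
pose A := \matrix_(i < \dim U) (vbasis U)`_i.
have SA v : (v \in S) = (v <= A)%MS.
  rewrite -US; apply/idP/submxP => [/coord_vbasis ->|[D ->]].
    exists (\row_i coord (vbasis U) i v); rewrite mulmx_sum_row.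
    by apply: eq_bigr => i _; rewrite rowK mxE.
  rewrite mulmx_sum_row; apply: rpred_sum => i _; apply: rpredZ.
  by rewrite rowK vbasis_mem ?mem_nth ?size_tuple.
have [B freeB SB] : exists2 B : 'M[rat]_(\rank A, N),
    row_free B & forall v, (v \in S) = (v <= B)%MS.
  exists (row_base A) => [|v]; first exact: row_base_free.
  by rewrite SA eq_row_base.
have unitBB : B *m B^T \in unitmx.
  rewrite -row_free_unit; apply: inj_row_free => v vBB.
  have /mulmx_tr_eq0/eqP : v *m B *m (v *m B)^T = 0.
    by rewrite trmx_mul mulmxA -(mulmxA v B) vBB mul0mx.
  by rewrite mulmx_free_eq0 // => /eqP.
have BP : B *m (B^T *m invmx (B *m B^T) *m B) = B.
  by rewrite !mulmxA mulmxV // mul1mx.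
exists (B^T *m invmx (B *m B^T) *m B); split=> [||v].
- by rewrite !trmx_mul trmxK trmx_inv trmx_mul trmxK mulmxA.
- by rewrite -[LHS]mulmxA BP.
- rewrite SB; apply/submxP/eqP => [[D ->]|<-].
    by rewrite -[LHS]mulmxA BP.
  by eexists; rewrite mulmxA.
Qed.

Lemma orth_projection_mx N (P : 'M[rat]_N) (S : submod 'rV[rat]_N) m
    (A : 'M[rat]_(m, N)) :
  (forall v, (v \in S) = (v *m P == v)) ->
  (forall i, row i A \in S) <-> A *m P = A.
Proof.
move=> SP; split=> [SA|AP i].
  by apply/row_matrixP => i; rewrite row_mul; apply/eqP; rewrite -SP.
by rewrite SP -row_mul AP.
Qed.

(** * Orthogonal representations *)

(** Matrices act on row vectors, hence on the right: this is why [rho] reverses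
    products.  The group may be infinite, so complements come from orthogonality
    and not from averaging. *)
Section OrthogonalRepresentation.
Variables (G : groupType) (N : nat) (rho : G -> 'M[rat]_N).
Hypothesis rho1 : rho 1%g = 1%:M.
Hypothesis rhoM : forall g h, rho (g * h)%g = rho h *m rho g.
Hypothesis rhoT : forall g, (rho g)^T = rho g^-1%g.

(** The commutant of the representation. *)
Definition comm (T : 'M[rat]_N) : Prop := forall g, rho g *m T = T *m rho g.

Lemma comm0 : comm 0. Proof. by move=> g; rewrite mulmx0 mul0mx. Qed.
Lemma comm1 : comm 1%:M. Proof. by move=> g; rewrite mulmx1 mul1mx. Qed.
Lemma commD S T : comm S -> comm T -> comm (S + T).
Proof. by move=> cS cT g; rewrite mulmxDl mulmxDr cS cT. Qed.
Lemma commB S T : comm S -> comm T -> comm (S - T).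
Proof. by move=> cS cT g; rewrite mulmxBl mulmxBr cS cT. Qed.
Lemma commZ a T : comm T -> comm (a *: T).
Proof. by move=> cT g; rewrite -scalemxAl -scalemxAr cT. Qed.
Lemma commM S T : comm S -> comm T -> comm (S *m T).
Proof. by move=> cS cT g; rewrite mulmxA cS -!mulmxA cT. Qed.
Lemma comm_tr T : comm T -> comm T^T.
Proof.
move=> cT g; apply: trmx_inj; rewrite !trmx_mul trmxK rhoT.
by rewrite cT.
Qed.
Lemma comm_sum (I : Type) (r : seq I) (P : pred I) (T : I -> 'M[rat]_N) :
  (forall i, P i -> comm (T i)) -> comm (\sum_(i <- r | P i) T i).
Proof. by move=> cT; apply: big_ind => //; [exact: comm0|exact: commD]. Qed.
Lemma comm_inv T : T \in unitmx -> comm T -> comm (invmx T).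
Proof.
move=> uT cT g; apply: (can_inj (mulmxK uT)); rewrite mulmxKV //.
by rewrite -mulmxA cT mulKmx.
Qed.

(** The orthogonal projection onto an invariant subspace. *)
Record orthproj (p : 'M[rat]_N) : Prop := OrthProj {
  projT : p^T = p; projI : p *m p = p; projC : comm p }.

Lemma orthprojB p q : orthproj p -> orthproj q -> q *m p = q ->
  orthproj (p - q).
Proof.
move=> [pT pI pC] [qT qI qC] qp.
have pq : p *m q = q by apply: trmx_inj; rewrite trmx_mul pT qT.
split; [by rewrite linearB /= pT qT| |exact: commB].
by rewrite mulmxBl !mulmxBr pI qI qp pq subrr subr0.
Qed.

Lemma orthproj0 : orthproj 0.
Proof. by split; [exact: trmx0|rewrite mul0mx|exact: comm0]. Qed.

Lemma orthprojD p q : orthproj p -> orthproj q -> p *m q = 0 ->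
  orthproj (p + q).
Proof.
move=> [pT pI pC] [qT qI qC] pq.
have qp : q *m p = 0 by apply: trmx_inj; rewrite trmx_mul pT qT pq trmx0.
split; [by rewrite linearD /= pT qT| |exact: commD].
by rewrite mulmxDl !mulmxDr pI qI qp pq addr0 add0r.
Qed.

Lemma invariant_projection (S : submod 'rV[rat]_N) :
  (forall g v, v \in S -> v *m rho g \in S) ->
  exists2 P, orthproj P & forall v, (v \in S) = (v *m P == v).
Proof.
move=> invS; have [P [PT PI SP]] := orth_projection S.
exists P => //; split=> // g.
(* the rows of [P *m rho h] lie in [S]; transpose this for [h = g^-1] *)
have PgP h : P *m rho h *m P = P *m rho h.
  apply/(orth_projection_mx _ SP) => i; rewrite row_mul; apply: invS.
  by move: i; apply/(orth_projection_mx _ SP).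
rewrite -PgP; apply: trmx_inj; rewrite !trmx_mul PT !rhoT mulmxA.
by rewrite PgP.
Qed.

Lemma fix_closed (p : 'M[rat]_N) : submod_closed [pred v : 'rV[rat]_N | v *m p == v].
Proof.
split=> [|a u v]; rewrite !inE ?mul0mx // => /eqP up /eqP vp.
by rewrite mulmxDl -scalemxAl up vp.
Qed.

(** The image of [p], when [p] is idempotent. *)
Definition fixS p : submod 'rV[rat]_N := Submod (fix_closed p).

Lemma fixSP p v : reflect (v *m p = v) (v \in fixS p).
Proof. exact: eqP. Qed.

Section ImageRep.
Variables (p : 'M[rat]_N) (op : orthproj p).

Lemma im_actP g (v : submodule (fixS p)) : val v *m rho g \in fixS p.
Proof. by apply/fixSP; rewrite -mulmxA (projC op) mulmxA (fixSP _ _ (valP v)). Qed.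

Definition im_act g (v : submodule (fixS p)) : submodule (fixS p) :=
  SubCarrier (im_actP g v).

Lemma im_act_linear g : linear (im_act g).
Proof. by move=> a u v; apply: val_inj; rewrite /= mulmxDl scalemxAl. Qed.

HB.instance Definition _ g :=
  GRing.isLinear.Build rat (submodule (fixS p)) (submodule (fixS p)) *:%R
    (im_act g) (im_act_linear g).

Lemma im_act1 v : im_act 1%g v = v.
Proof. by apply: val_inj; rewrite /= rho1 mulmx1. Qed.

Lemma im_actM g h v : im_act (g * h)%g v = im_act g (im_act h v).
Proof. by apply: val_inj; rewrite /= rhoM mulmxA. Qed.

(** The representation of [G] on the image of the projection [p]. *)
Definition im_rep : rep G := @Rep G (submodule (fixS p)) im_act im_act1 im_actM.
End ImageRep.

End OrthogonalRepresentation.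

(** * Isomorphisms and direct sums of representations *)
Definition linear_of (R : pzRingType) (V W : lmodType R) (f : V -> W)
    (fl : linear f) : {linear V -> W} :=
  HB.pack_for {linear V -> W} f (GRing.isLinear.Build R V W *:%R f fl).

Lemma linear_inverse (R : pzRingType) (V W : lmodType R) (f : {linear V -> W}) :
  bijective f -> exists k : {linear W -> V}, cancel f k /\ cancel k f.
Proof.
move=> [k fK kK].
have kl : linear k.
  by move=> a u v; apply: (can_inj fK); rewrite linearP !kK.
by exists (linear_of kl).
Qed.

Section RepIso.
Variable G : groupType.
Implicit Types V W : rep G.

Lemma rep_iso_refl V : rep_iso V V.
Proof. by exists idfun; split=> //; exists idfun. Qed.

Lemma rep_iso_sym V W : rep_iso V W -> rep_iso W V.
Proof.
move=> [f [bf fG]]; have [k [fK kK]] := linear_inverse bf.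
exists k; split=> [|g v]; first by exists f.
by apply: (can_inj fK); rewrite fG !kK.
Qed.

Lemma rep_iso_trans V W X : rep_iso V W -> rep_iso W X -> rep_iso V X.
Proof.
move=> [f [bf fG]] [h [bh hG]]; exists (h \o f).
by split=> [|g v /=]; [exact: bij_comp|rewrite fG hG].
Qed.

Lemma rep_iso_dsum V V' W W' : rep_iso V V' -> rep_iso W W' ->
  rep_iso (rep_dsum V W) (rep_dsum V' W').
Proof.
move=> [f [bf fG]] [h [bh hG]].
have [f' [fK f'K]] := linear_inverse bf.
have [h' [hK h'K]] := linear_inverse bh.
pose F (p : (V * W)%type) : (V' * W')%type := (f p.1, h p.2).
have Fl : linear F by move=> a p q; rewrite /F /= !linearP.
exists (linear_of Fl); split=> [|g [v w]].
  by exists (fun p => (f' p.1, h' p.2)) => -[v w]; rewrite /F /= ?fK ?hK ?f'K ?h'K.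
by rewrite /= /F /dsum_fun /= fG hG.
Qed.

Lemma rep_iso_dsumA V W X :
  rep_iso (rep_dsum V (rep_dsum W X)) (rep_dsum (rep_dsum V W) X).
Proof.
pose F (p : (V * (W * X))%type) : ((V * W) * X)%type := (p.1, p.2.1, p.2.2).
have Fl : linear F by [].
exists (linear_of Fl); split=> [|g [v [w x]]] //.
by exists (fun p => (p.1.1, (p.1.2, p.2))) => [[v [w x]]|[[v w] x]].
Qed.

Lemma rep_iso_dsum0 V : rep_iso (rep_dsum (rep_zero G) V) V.
Proof.
have sl : linear (snd : ('rV[rat]_0 * V)%type -> V) by [].
exists (linear_of sl); split=> //.
by exists (fun v => (0, v)) => //= -[u v] /=; rewrite (thinmx0 u).
Qed.

Lemma rep_bigsum_cat (Vs Ws : seq (rep G)) :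
  rep_iso (rep_dsum (rep_bigsum Vs) (rep_bigsum Ws)) (rep_bigsum (Vs ++ Ws)).
Proof.
elim: Vs => [|V Vs IH] /=; first exact: rep_iso_dsum0.
apply: rep_iso_trans (rep_iso_sym (rep_iso_dsumA _ _ _)) _.
exact: rep_iso_dsum (rep_iso_refl _) IH.
Qed.

End RepIso.

(** * Images of projections as representations *)
Section ImageRepTheory.
Variables (G : groupType) (N : nat) (rho : G -> 'M[rat]_N).
Hypothesis rho1 : rho 1%g = 1%:M.
Hypothesis rhoM : forall g h, rho (g * h)%g = rho h *m rho g.
Hypothesis rhoT : forall g, (rho g)^T = rho g^-1%g.

Local Notation comm := (comm rho).
Local Notation orthproj := (orthproj rho).
Local Notation im_rep := (im_rep rho1 rhoM).

Lemma im_val (p : 'M[rat]_N) (v : submodule (fixS p)) : val v *m p = val v.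
Proof. exact/fixSP/valP. Qed.

(** A matrix with rows in the image of [q] maps the image of [p] into it. *)
Section MatrixHom.
Variables (p q T : 'M[rat]_N) (op : orthproj p) (oq : orthproj q).
Hypothesis Tq : T *m q = T.

Lemma im_homP (v : submodule (fixS p)) : val v *m T \in fixS q.
Proof. by apply/fixSP; rewrite -mulmxA Tq. Qed.

Definition im_hom_fun (v : submodule (fixS p)) : submodule (fixS q) :=
  SubCarrier (im_homP v).

Lemma im_hom_linear : linear im_hom_fun.
Proof. by move=> a u v; apply: val_inj; rewrite /= mulmxDl scalemxAl. Qed.

HB.instance Definition _ :=
  GRing.isLinear.Build rat (submodule (fixS p)) (submodule (fixS q)) *:%R
    im_hom_fun im_hom_linear.

Definition im_hom : {linear im_rep op -> im_rep oq} := im_hom_fun.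

Lemma im_homG : comm T ->
  forall g v, im_hom (rep_act g v) = rep_act g (im_hom v).
Proof. by move=> cT g v; apply: val_inj; rewrite /= -!mulmxA cT. Qed.

End MatrixHom.

(** Every homomorphism between images comes from a matrix of the commutant. *)
Lemma im_hom_matrix p q (op : orthproj p) (oq : orthproj q)
    (f : {linear im_rep op -> im_rep oq}) :
  (forall g v, f (rep_act g v) = rep_act g (f v)) ->
  exists T, [/\ comm T, p *m T = T, T *m q = T
    & forall v, val (f v) = val v *m T].
Proof.
move=> fG.
have projP v : v *m p \in fixS p by apply/fixSP; rewrite -mulmxA (projI op).
pose pr v : im_rep op := SubCarrier (projP v).
pose T := \matrix_i val (f (pr (delta_mx 0 i))).
have prD : linear pr by move=> a u v; apply: val_inj; rewrite /= mulmxDl scalemxAl.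
have vT v : v *m T = val (f (pr v)).
  pose h : {linear 'rV[rat]_N -> 'rV[rat]_N} :=
    (val : {linear submodule (fixS q) -> 'rV[rat]_N}) \o (f \o linear_of prD).
  rewrite -[RHS]/(h v) {2}[v]row_sum_delta mulmx_sum_row linear_sum.
  by apply: eq_bigr => i _; rewrite rowK linearZ.
have prK (v : im_rep op) : pr (val v) = v by apply: val_inj; exact: im_val.
have mxP (A B : 'M[rat]_N) : (forall v : 'rV_N, v *m A = v *m B) -> A = B.
  by move=> AB; apply/row_matrixP => i; rewrite !rowE.
exists T; split=> [g|||v].
- apply: mxP => v; rewrite !mulmxA !vT -[RHS]/(val (rep_act g (f (pr v)))) -fG.
  by congr (val (f _)); apply: val_inj; rewrite /= -!mulmxA (projC op).
- apply: mxP => v; rewrite mulmxA !vT; congr (val (f _)); apply: val_inj.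
  by rewrite /= -mulmxA (projI op).
- by apply: mxP => v; rewrite mulmxA !vT im_val.
- by rewrite vT prK.
Qed.

Lemma im_rep_dsum p q r (op : orthproj p) (oq : orthproj q) (or : orthproj r) :
  r = p + q -> p *m q = 0 -> rep_iso (im_rep or) (rep_dsum (im_rep op) (im_rep oq)).
Proof.
move=> er pq; apply: rep_iso_sym.
have qp : q *m p = 0.
  by apply: trmx_inj; rewrite trmx_mul (projT op) (projT oq) pq trmx0.
have sumP (u : submodule (fixS p) * submodule (fixS q)) :
    val u.1 + val u.2 \in fixS r.
  apply/fixSP; rewrite er mulmxDl !mulmxDr !im_val -(im_val u.1) -(im_val u.2).
  by rewrite -!mulmxA pq qp !mulmx0 addr0 add0r.
pose F u : im_rep or := SubCarrier (sumP u).
have Fl : linear (F : (im_rep op * im_rep oq)%type -> im_rep or).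
  by move=> a u v; apply: val_inj; rewrite /= scalerDr addrACA.
have pP (v : submodule (fixS r)) : val v *m p \in fixS p.
  by apply/fixSP; rewrite -mulmxA (projI op).
have qP (v : submodule (fixS r)) : val v *m q \in fixS q.
  by apply/fixSP; rewrite -mulmxA (projI oq).
exists (linear_of Fl); split=> [|g [u v]].
  exists (fun v => (SubCarrier (pP v), SubCarrier (qP v))) => [[u v]|v] /=.
    congr (_, _); apply: val_inj; rewrite /= mulmxDl !im_val.
      by rewrite -(im_val v) -mulmxA qp mulmx0 addr0.
    by rewrite -(im_val u) -mulmxA pq mulmx0 add0r.
  by apply: val_inj; rewrite /= -mulmxDr -er im_val.
by apply: val_inj; rewrite /= mulmxDl.
Qed.

Lemma im_rep_zero (p : 'M[rat]_N) (op : orthproj p) :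
  p = 0 -> rep_iso (im_rep op) (rep_zero G).
Proof.
move=> p0; have v0 (v : im_rep op) : v = 0.
  have vp0 (w : 'rV[rat]_N) : w *m p = 0 by rewrite p0 mulmx0.
  by apply: val_inj; rewrite -[LHS]im_val vp0.
have Fl : linear ((fun _ => 0) : im_rep op -> 'rV[rat]_0).
  by move=> a u v; rewrite scaler0 addr0.
exists (linear_of Fl); split=> [|g v] //.
by exists (fun _ => 0) => [v|v]; [rewrite (v0 v)|rewrite [RHS]thinmx0 [LHS]thinmx0].
Qed.

(** The subrepresentations of the image of [p] are the images of the projections
    [q] below [p]. *)
Lemma im_sub_projection p (op : orthproj p) (S : submod (im_rep op)) :
  (forall g v, v \in S -> rep_act g v \in S) ->
  exists q, [/\ orthproj q, q *m p = q
    & forall v : im_rep op, (v \in S) = (val v *m q == val v)].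
Proof.
move=> invS.
have Scl : submod_closed
    [pred v : 'rV[rat]_N | `[< exists2 u : im_rep op, u \in S & val u = v >]].
  split=> [|a v1 v2]; rewrite !inE; first by exists 0; rewrite ?rpred0.
  move=> [u1 S1 <-] [u2 S2 <-].
  by exists (a *: u1 + u2) => //; apply: rpredD => //; apply: rpredZ.
have [g v /asboolP[u Su <-]|q oq Sq] := invariant_projection rhoT (S := Submod Scl).
  by apply/asboolP; exists (rep_act g u) => //; apply: invS.
exists q; split=> // [|v].
  apply/row_matrixP => i; rewrite row_mul.
  have : row i q \in Submod Scl by rewrite Sq -row_mul (projI oq).
  by move=> /asboolP[u _ <-]; rewrite im_val.
rewrite -Sq; apply/idP/asboolP => [Sv|[u Su /val_inj <-] //].
by exists v.
Qed.

Lemma im_rep_neq0 p (op : orthproj p) : p != 0 -> exists v : im_rep op, v <> 0.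
Proof.
move=> p0; have [i pi] : exists i, row i p != 0.
  apply/existsP; apply: contraNT p0; rewrite negb_exists => /forallP h.
  by apply/eqP/row_matrixP => i; rewrite row0; apply/eqP; have := h i; rewrite negbK.
have rP : row i p \in fixS p by apply/fixSP; rewrite -row_mul (projI op).
by exists (SubCarrier rP) => /(congr1 val) /= e; rewrite e eqxx in pi.
Qed.

(** The projection onto an invariant subspace is a scalar multiple of [e], and
    idempotent, so it is 0 or [e]. *)
Lemma im_rep_irreducible (e : 'M[rat]_N) (oe : orthproj e) :
  e != 0 -> (forall T, comm T -> exists c, e *m T *m e = c *: e) ->
  irreducible (im_rep oe).
Proof.
move=> e0 scal; split=> [|S invS]; first exact: im_rep_neq0.
have [q [oq qe Sq]] := im_sub_projection invS.
have eq : e *m q = q.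
  by apply: trmx_inj; rewrite trmx_mul (projT oq) (projT oe).
have [c] := scal q (projC oq); rewrite eq qe => qc.
have : (c * c) *: e = c *: e.
  by rewrite -[RHS]qc -(projI oq) qc -scalemxAl -scalemxAr (projI oe) scalerA.
move=> /eqP; rewrite -subr_eq0 -scalerBl scaler_eq0 (negPf e0) orbF.
rewrite -{3}(mulr1 c) -mulrBr mulf_eq0 subr_eq0 => /orP[]/eqP c0; [left|right].
  move=> v; rewrite Sq qc c0 scale0r mulmx0 => /eqP ev.
  by apply: val_inj; rewrite -ev.
by move=> v; rewrite Sq qc c0 scale1r im_val.
Qed.

End ImageRepTheory.

(** * Multiplicities as dimensions of spaces of homomorphisms *)
Section Multiplicity.
Variables (G : groupType) (N : nat) (rho : G -> 'M[rat]_N).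
Hypothesis rho1 : rho 1%g = 1%:M.
Hypothesis rhoM : forall g h, rho (g * h)%g = rho h *m rho g.
Hypothesis rhoT : forall g, (rho g)^T = rho g^-1%g.

Local Notation comm := (comm rho).
Local Notation orthproj := (orthproj rho).
Local Notation im_rep := (im_rep rho1 rhoM).

Lemma hom_closed (p e : 'M[rat]_N) :
  submod_closed [pred T : 'M[rat]_N | `[< [/\ comm T, p *m T = T & T *m e = T] >]].
Proof.
split=> [|a S T]; rewrite !inE.
  by split; rewrite ?mulmx0 ?mul0mx //; exact: comm0.
move=> [cS pS Se] [cT pT Te]; split; first by apply: commD => //; exact: commZ.
  by rewrite mulmxDr -scalemxAr pS pT.
by rewrite mulmxDl -scalemxAl Se Te.
Qed.

(** The homomorphisms from the image of [p] to the image of [e], as matrices. *)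
Definition hom_space (p e : 'M[rat]_N) : {vspace 'M[rat]_N} :=
  projT1 (cid (submod_vspace (Submod (hom_closed p e)))).

Lemma hom_spaceP (p e T : 'M[rat]_N) :
  reflect [/\ comm T, p *m T = T & T *m e = T] (T \in hom_space p e).
Proof. by rewrite /hom_space; case: cid => U /= ->; apply: asboolP. Qed.

Lemma hom_space_dim0 (e : 'M[rat]_N) : \dim (hom_space 0 e) = 0%N.
Proof.
apply/eqP; rewrite dimv_eq0 -subv0; apply/subvP => T /hom_spaceP[_ <- _].
by rewrite mul0mx mem0v.
Qed.

Lemma hom_space_dimD p q (e : 'M[rat]_N) : orthproj p -> orthproj q ->
  p *m q = 0 -> q *m p = 0 ->
  \dim (hom_space (p + q) e) = (\dim (hom_space p e) + \dim (hom_space q e))%N.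
Proof.
move=> op oq pq qp; rewrite -dimv_disjoint_sum; last first.
  apply/eqP; rewrite -subv0; apply/subvP => T.
  rewrite memv_cap => /andP[/hom_spaceP[_ pT _] /hom_spaceP[_ qT _]].
  by rewrite -pT -qT mulmxA pq mul0mx mem0v.
congr (\dim _); apply/vspaceP => T.
apply/hom_spaceP/memv_addP => [[cT pT Te]|].
  exists (p *m T); first apply/hom_spaceP; first split.
  - exact: commM (projC op) cT.
  - by rewrite mulmxA (projI op).
  - by rewrite -mulmxA Te.
  exists (q *m T); last by rewrite -mulmxDl.
  apply/hom_spaceP; split; first exact: commM (projC oq) cT.
    by rewrite mulmxA (projI oq).
  by rewrite -mulmxA Te.
move=> [S /hom_spaceP[cS pS Se]] [S' /hom_spaceP[cS' qS' Se'] ->].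
split; first exact: commD.
  have pS'0 : p *m S' = 0 by rewrite -qS' mulmxA pq mul0mx.
  have qS0 : q *m S = 0 by rewrite -pS mulmxA qp mul0mx.
  by rewrite mulmxDl !mulmxDr pS qS' pS'0 qS0 addr0 add0r.
by rewrite mulmxDl Se Se'.
Qed.

(** In the rest of the section [e] has only scalar endomorphisms over [rat]. *)
Variables (e : 'M[rat]_N) (oe : orthproj e).
Hypothesis e_scalar : forall T, comm T -> exists c, e *m T *m e = c *: e.

Lemma hom_scalar S T : comm S -> comm T -> S *m e = S -> T *m e = T ->
  exists c, S^T *m T = c *: e.
Proof.
move=> cS cT Se Te.
have eS : e *m S^T = S^T by rewrite -{1}(projT oe) -trmx_mul Se.
have [c] := e_scalar (commM (comm_tr rhoT cS) cT).
by rewrite mulmxA eS -mulmxA Te; exists c.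
Qed.

(** A nonzero homomorphism [T] from an irreducible image to that of [e] is
    bijective, with inverse a multiple of [T^T], and spans all homomorphisms. *)
Lemma hom_irreducible p (op : orthproj p) T :
  irreducible (im_rep op) -> T \in hom_space p e -> T != 0 ->
  rep_iso (im_rep oe) (im_rep op) /\
  forall S, S \in hom_space p e -> exists a, S = a *: T.
Proof.
move=> [_ irrp] /hom_spaceP[cT pT Te] T0.
have kerP : submod_closed [pred v : im_rep op | val v *m T == 0].
  split=> [|a u v]; rewrite !inE /= ?mul0mx // => /eqP u0 /eqP v0.
  by rewrite mulmxDl -scalemxAl u0 v0 scaler0 addr0.
have Tinj (v : im_rep op) : val v *m T = 0 -> v = 0.
  have [g v1 /eqP v1T|triv /eqP|tot _] := irrp (Submod kerP).
  - by apply/eqP; rewrite /= -mulmxA cT mulmxA v1T mul0mx.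
  - exact: triv.
  case/eqP: T0; apply/row_matrixP => i; rewrite row0.
  have rP : row i p \in fixS p by apply/fixSP; rewrite -row_mul (projI op).
  by have /eqP := tot (SubCarrier rP); rewrite /= -row_mul pT.
have [c Tc] := hom_scalar cT cT Te Te.
have c0 : c != 0.
  apply: contraNneq T0 => c0; apply/eqP/tr_mulmx_eq0.
  by rewrite Tc c0 scale0r.
have Tp : T^T *m p = T^T by rewrite -{1}(projT op) -trmx_mul pT.
have TTp : T *m T^T = c *: p.
  apply/row_matrixP => i; apply/eqP; rewrite -subr_eq0 -linearB /=.
  have rP : row i (T *m T^T - c *: p) \in fixS p.
    apply/fixSP; rewrite -row_mul mulmxBl -mulmxA Tp -scalemxAl.
    by rewrite (projI op).
  have /(congr1 val) /= -> : (SubCarrier rP : im_rep op) = 0 => //.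
  apply: Tinj => /=.
  by rewrite -row_mul mulmxBl -mulmxA Tc -scalemxAr Te -scalemxAl pT subrr row0.
split=> [|S /hom_spaceP[cS pS Se]].
  have cTe : c^-1 *: T *m e = c^-1 *: T by rewrite -scalemxAl Te.
  exists (im_hom rho1 rhoM oe op Tp); split; last exact: im_homG (comm_tr rhoT cT).
  exists (im_hom rho1 rhoM op oe cTe) => v; apply: val_inj => /=.
    by rewrite -mulmxA -scalemxAr Tc scalerA mulVf // scale1r im_val.
  by rewrite -scalemxAr -scalemxAl -mulmxA TTp -scalemxAr scalerA mulVf // scale1r im_val.
have [a TSa] := hom_scalar cT cS Te Se.
exists (c^-1 * a); rewrite -[LHS]scale1r -(mulVf c0) -!scalerA; congr (_ *: _).
by rewrite -{1}pS scalemxAl -TTp -mulmxA TSa -scalemxAr Te.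
Qed.

(** By induction on the rank: an image which is not irreducible splits as the sum of
    an invariant subspace and its orthogonal complement, and both sides of the
    equality of the count with the dimension are additive. *)
Lemma im_rep_decomposition p (op : orthproj p) :
  exists Vs : seq (rep G),
    [/\ all (fun V => `[< irreducible V >]) Vs, rep_iso (im_rep op) (rep_bigsum Vs)
      & count (fun W => `[< rep_iso (im_rep oe) W >]) Vs = \dim (hom_space p e)].
Proof.
have [n] := ubnP (\rank p); elim: n => // n IH in p op *; rewrite ltnS => rp.
have [p0|p0] := eqVneq p 0.
  exists [::]; split=> //; first exact: im_rep_zero.
  by rewrite p0 hom_space_dim0.
have [irrp|] := pselect (irreducible (im_rep op)).
  exists [:: im_rep op]; split=> /=; first by rewrite andbT; apply/asboolP.
    apply: rep_iso_sym; pose W := im_rep op; rewrite -/W.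
    have Fl : linear ((fun u => u.1) : (W * 'rV[rat]_0)%type -> W) by [].
    exists (linear_of Fl); split=> //; exists (fun v => (v, 0)) => //= -[v u] /=.
    by rewrite (thinmx0 u).
  rewrite addn0.
  have [h0|[T hT T0]] : hom_space p e = 0%VS \/ exists2 T, T \in hom_space p e & T != 0.
    have [h0|h0] := eqVneq (hom_space p e) 0%VS; [by left|right].
    by exists (vpick (hom_space p e)); rewrite ?memv_pick ?vpick0.
    rewrite h0 dimv0; case: asboolP => // -[f [[f' fK f'K] fG]].
    have [k [Kk kK]] := linear_inverse (Bijective fK f'K : bijective f).
    have kG g v : k (rep_act g v) = rep_act g (k v).
      by apply: (can_inj Kk); rewrite fG !kK.
    have [T [cT pT Te kT]] := im_hom_matrix kG.
    have : T \in hom_space p e by apply/hom_spaceP.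
    rewrite h0 memv0 => /eqP T0; have [[v v0] _] := irrp; case: v0.
    by apply: (can_inj kK); apply: val_inj; rewrite kT T0 mulmx0 linear0.
  have [iso hS] := hom_irreducible irrp hT T0.
  have -> : hom_space p e = <[T]>%VS.
    apply/vspaceP => S; apply/idP/vlineP => [/hS //|[a ->]].
    exact: memvZ.
  by rewrite dim_vline T0; case: asboolP.
move=> nirr.
have [S [invS [v [Sv v0]] [w Sw]]] : exists S : submod (im_rep op),
    [/\ forall g v, v \in S -> rep_act g v \in S,
     exists v, v \in S /\ v <> 0 & exists w, w \notin S].
  apply: contrapT => noS; apply: nirr; split; first exact: im_rep_neq0.
  move=> S invS; have [|/existsNP[v /not_implyP[Sv v0]]] :=
    pselect (forall v, v \in S -> v = 0); [by left|right => w].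
  by apply: contrapT => /negP Sw; apply: noS; exists S; split=> //; [exists v|exists w].
have [q [oq qp Sq]] := im_sub_projection rhoT invS.
have pq : p *m q = q.
  by apply: trmx_inj; rewrite trmx_mul (projT oq) (projT op).
have or := orthprojB op oq qp.
have pr : p = q + (p - q) by rewrite addrC subrK.
have qr : q *m (p - q) = 0 by rewrite mulmxBr qp (projI oq) subrr.
have rq : (p - q) *m q = 0 by rewrite mulmxBl pq (projI oq) subrr.
have lt_rank (s : 'M[rat]_N) : s *m p = s -> p *m s = s -> s *m s = s ->
      s != p -> (\rank s < \rank p)%N.
  move=> sp ps ss neq; rewrite ltn_neqAle mxrankS ?andbT; last by rewrite -sp submxMl.
  apply: contraNneq neq => rk; have : (p <= s)%MS.
    by have [_] := mxrank_leqif_sup (submxMl s p); rewrite sp rk eqxx => <-.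
  by move=> /submxP[D pD]; rewrite -ps {1}pD -mulmxA ss -pD.
have rq_lt : (\rank q < \rank p)%N.
  apply: (lt_rank _ _ _ (projI oq)) => //; apply: contraNneq Sw => qep.
  by rewrite Sq qep im_val.
have rr_lt : (\rank (p - q)%R < \rank p)%N.
  apply: (lt_rank _ _ _ (projI or)); rewrite ?mulmxBl ?mulmxBr ?(projI op) ?qp ?pq //.
  rewrite -subr_eq0 addrC addKr oppr_eq0; apply: contra_notN v0 => /eqP q0.
  by apply: val_inj; move: Sv; rewrite Sq q0 mulmx0 => /eqP <-.
have [Vs [irrV isoV cV]] := IH q oq (leq_trans rq_lt rp).
have [Ws [irrW isoW cW]] := IH (p - q) or (leq_trans rr_lt rp).
exists (Vs ++ Ws); split; first by rewrite all_cat irrV.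
  apply: rep_iso_trans _ (rep_bigsum_cat Vs Ws).
  apply: rep_iso_trans (im_rep_dsum rho1 rhoM oq or op pr qr) _.
  exact: rep_iso_dsum.
by rewrite count_cat cV cW -hom_space_dimD // -pr.
Qed.

Lemma im_rep_multiplicity p (op : orthproj p) V : rep_iso V (im_rep op) ->
  multiplicity (im_rep oe) V (\dim (hom_space p e)).
Proof.
move=> isoV; have [Vs [irrV isoVs cV]] := im_rep_decomposition op.
exists Vs; split=> //; last exact: rep_iso_trans isoVs.
by move=> i ltiVs; apply/asboolP; exact: (all_nthP (rep_zero G) irrV).
Qed.

End Multiplicity.

(** * Lattices with the properties of a symmetric couple *)

(** What is needed of the lattice of submodules of [F], indexed by ['I_N], with
    the action of [G = aut F].  [lat_fixes g k] stands for: [g] fixes the submodule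
    [k] pointwise.  [lat_top] is a submodule of type [phi]; its orbit consists of
    the submodules of type [phi] and is called the top orbit. *)
Record couple_lattice (G : groupType) (N : nat) := CoupleLattice {
  lat_act : G -> 'I_N -> 'I_N;
  lat_le : rel 'I_N;
  lat_meet : 'I_N -> 'I_N -> 'I_N;
  lat_fixes : G -> 'I_N -> Prop;
  lat_top : 'I_N;
  lat_act1 : forall x, lat_act 1%g x = x;
  lat_actM : forall g h x, lat_act (g * h)%g x = lat_act g (lat_act h x);
  lat_refl : reflexive lat_le;
  lat_trans : transitive lat_le;
  lat_anti : antisymmetric lat_le;
  lat_leI : forall z x y, lat_le z (lat_meet x y) = lat_le z x && lat_le z y;
  lat_le_act : forall g x y, lat_le (lat_act g x) (lat_act g y) = lat_le x y;
  lat_fixes_act : forall g k z, lat_fixes g k -> lat_le z k -> lat_act g z = z;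
  lat_fixesV : forall g k, lat_fixes g k -> lat_fixes g^-1%g k;
  lat_fixesM : forall g h k, lat_fixes g k -> lat_fixes h k -> lat_fixes (g * h)%g k;
  lat_fixes_le : forall g k z, lat_fixes g k -> lat_le z k -> lat_fixes g z;
  (* if [g] fixes the meet of [w] and [x], and [act g w] meets [x] in the same
     element, then the pairs [(x, w)] and [(x, act g w)] are conjugate *)
  lat_glue : forall g x w, lat_fixes g (lat_meet w x) ->
    lat_meet (lat_act g w) x = lat_meet w x ->
    exists h, lat_act h x = x /\ lat_act h w = lat_act g w;
  (* the symmetry of [phi]: two elements of the top orbit above [k] are conjugate
     by an element fixing [k] *)
  lat_homog : forall k g h, lat_le k (lat_act g lat_top) ->
    lat_le k (lat_act h lat_top) ->
    exists2 b, lat_fixes b k & lat_act b (lat_act g lat_top) = lat_act h lat_top;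
  (* an element of the top orbit above [x] can be moved to meet [x] in any given
     [k <= x], while [k] is fixed *)
  lat_meet_all : forall k x g, lat_le k x -> lat_le x (lat_act g lat_top) ->
    exists2 a, lat_fixes a k & lat_meet (lat_act a (lat_act g lat_top)) x = k }.

Section OrbitEnumeration.
Variables (G : groupType) (N : nat) (L : couple_lattice G N).
Local Notation act := (lat_act L).
Local Notation le := (lat_le L).
Local Notation meet := (lat_meet L).
Local Notation fixes := (lat_fixes L).
Local Notation f0 := (lat_top L).

Lemma actK g : cancel (act g) (act g^-1%g).
Proof. by move=> x; rewrite -lat_actM mulVg lat_act1. Qed.

Lemma actVK g : cancel (act g^-1%g) (act g).
Proof. by move=> x; rewrite -lat_actM mulgV lat_act1. Qed.

Lemma meetl x y : le (meet x y) x.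
Proof. by have := lat_refl L (meet x y); rewrite lat_leI => /andP[]. Qed.

Lemma meetr x y : le (meet x y) y.
Proof. by have := lat_refl L (meet x y); rewrite lat_leI => /andP[]. Qed.

Lemma le_ext x y : (forall z, le z x = le z y) -> x = y.
Proof.
by move=> xy; apply: (@lat_anti _ _ L); move: (xy x) (xy y); rewrite !lat_refl => <- ->.
Qed.

Lemma act_meet g x y : act g (meet x y) = meet (act g x) (act g y).
Proof.
by apply: le_ext => z; rewrite -(actVK g z) lat_leI !lat_le_act lat_leI.
Qed.

(** The number of elements below [x]: a strictly increasing invariant. *)
Definition height x := #|[set y | le y x]|.

Lemma le_height x y : le x y -> (height x <= height y)%N.
Proof.
move=> xy; rewrite subset_leq_card //; apply/fintype.subsetP => z; rewrite !inE => zx.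
exact: lat_trans zx xy.
Qed.

Lemma height_eq x y : le x y -> height x = height y -> x = y.
Proof.
move=> xy hxy; have /eqP exy : [set z | le z x] == [set z | le z y].
  rewrite eqEcard -/(height x) -/(height y) hxy leqnn andbT.
  by apply/fintype.subsetP => z; rewrite !inE => zx; apply: lat_trans zx xy.
by apply: le_ext => z; move/setP/(_ z): exy; rewrite !inE.
Qed.

Lemma height_act g x : height (act g x) = height x.
Proof.
apply: esym; rewrite /height -(card_imset _ (can_inj (actK g))).
apply: eq_card => z; rewrite -(actVK g z) mem_imset ?inE ?lat_le_act //.
exact: can_inj (actK g).
Qed.

(** [x] and [y] lie in the same orbit, that is, have the same type. *)
Definition orb x y := `[< exists g, act g x = y >].

Lemma orbP x y : reflect (exists g, act g x = y) (orb x y).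
Proof. exact: asboolP. Qed.

Lemma orb_refl x : orb x x.
Proof. by apply/orbP; exists 1%g; rewrite lat_act1. Qed.

Lemma orb_sym x y : orb x y = orb y x.
Proof.
by apply/orbP/orbP => -[g <-]; exists g^-1%g; rewrite actK.
Qed.

Lemma orb_act g x y : orb x (act g y) = orb x y.
Proof.
apply/orbP/orbP => -[h xy].
  by exists (g^-1 * h)%g; rewrite lat_actM xy actK.
by exists (g * h)%g; rewrite lat_actM xy.
Qed.

Lemma orb_actl g x y : orb (act g x) y = orb x y.
Proof. by rewrite orb_sym orb_act orb_sym. Qed.

Lemma orb_trans x y z : orb x y -> orb y z = orb x z.
Proof. by move=> /orbP[g <-]; rewrite orb_actl. Qed.

(** [x] lies below an element of the top orbit: its type is at most [phi]. *)
Definition small x := [exists f, orb f0 f && le x f].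

Lemma small_le x y : le x y -> small y -> small x.
Proof.
move=> xy /existsP[f /andP[f0f yf]]; apply/existsP; exists f.
by rewrite f0f (lat_trans xy yf).
Qed.

Lemma small_act g x : small (act g x) = small x.
Proof.
apply/existsP/existsP => -[f /andP[f0f xf]].
  by exists (act g^-1%g f); rewrite orb_act f0f -(actK g x) lat_le_act.
by exists (act g f); rewrite orb_act f0f lat_le_act.
Qed.

Lemma small_top : small f0.
Proof. by apply/existsP; exists f0; rewrite orb_refl lat_refl. Qed.

(** The canonical representative of the orbit of [x]. *)
Definition orep x := odflt x [pick y | orb x y].

Lemma orb_orep x : orb x (orep x).
Proof.
by rewrite /orep; case: pickP => //= /(_ x); rewrite orb_refl.
Qed.

Lemma orep_eq x y : orb x y -> orep x = orep y.
Proof.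
move=> xy; rewrite /orep.
rewrite (eq_pick (Q := orb y)) => [|z /=]; last by rewrite (orb_trans _ xy).
by case: pickP => //= /(_ y); rewrite orb_refl.
Qed.

(** Representatives of the small orbits (the types below [phi]), sorted by height
    so that the order of the list extends the order of types. *)
Definition orbits : seq 'I_N :=
  sort (relpre height leq) [seq x <- enum 'I_N | small x && (orep x == x)].

(** The position in [orbits] of the orbit of [x]; it is [size orbits] when [x] is
    not small. *)
Definition orb_pos x := index (orep x) orbits.

Lemma orep_small x : small (orep x) = small x.
Proof. by have /orbP[g <-] := orb_orep x; rewrite small_act. Qed.

Lemma mem_orbits x : (orep x \in orbits) = small x.
Proof.
rewrite mem_sort mem_filter orep_small mem_enum andbT.
by rewrite -(orep_eq (orb_orep x)) eqxx andbT.
Qed.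

Lemma orb_pos_small x : (orb_pos x < size orbits)%N = small x.
Proof. by rewrite index_mem mem_orbits. Qed.

Lemma orb_pos_act g x : orb_pos (act g x) = orb_pos x.
Proof. by rewrite /orb_pos -(@orep_eq x) // orb_act orb_refl. Qed.

Lemma orb_pos_orb x y : small x -> (orb_pos x == orb_pos y) = orb x y.
Proof.
move=> sx; apply/eqP/idP => [exy|/orbP[g <-]]; last by rewrite orb_pos_act.
have sy : small y by rewrite -orb_pos_small -exy orb_pos_small.
have eo : orep x = orep y.
  rewrite -(@nth_index _ x (orep x) orbits) ?mem_orbits //.
  by rewrite -[index _ _]/(orb_pos x) exy nth_index ?mem_orbits.
by rewrite -(orb_trans _ (orb_orep x)) eo orb_sym orb_orep.
Qed.

Lemma uniq_orbits : uniq orbits.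
Proof. by rewrite sort_uniq filter_uniq ?enum_uniq. Qed.

Lemma orb_pos_nth i : (i < size orbits)%N -> orb_pos (nth f0 orbits i) = i.
Proof.
move=> lti; have := mem_nth f0 lti; set x := nth _ _ _.
rewrite mem_sort mem_filter => /andP[/andP[_ /eqP ex] _].
by rewrite /orb_pos ex /x index_uniq ?uniq_orbits.
Qed.

Lemma height_orep x : height (orep x) = height x.
Proof. by have /orbP[g <-] := orb_orep x; rewrite height_act. Qed.

Lemma orb_pos_le x y : le x y -> small y -> (orb_pos x <= orb_pos y)%N.
Proof.
move=> xy sy; have sx := small_le xy sy.
rewrite leqNgt; apply/negP => lt_cl.
have sorted_orb : sorted (relpre height leq) orbits.
  by apply: sort_sorted => u v; exact: leq_total.
have hyx : (height y <= height x)%N.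
  rewrite -height_orep -(height_orep x).
  have := sorted_ltn_nth (leT := relpre height leq)
    (fun _ _ _ => @leq_trans _ _ _) f0 sorted_orb.
  move=> /(_ (orb_pos y) (orb_pos x)); rewrite !inE !orb_pos_small sx sy.
  move=> /(_ isT isT lt_cl).
  by rewrite /= !nth_index ?mem_orbits.
have exy : x = y by apply: height_eq => //; apply/eqP; rewrite eqn_leq le_height.
by rewrite exy ltnn in lt_cl.
Qed.

End OrbitEnumeration.

(** * The filtration of the functions on the top orbit *)
Lemma sum_tr_mulmx_eq0 m n k (A : 'I_k -> 'M[rat]_(m, n)) :
  \sum_(j < k) (A j)^T *m A j = 0 -> forall j, A j = 0.
Proof.
move=> sum0 j; apply/matrixP => a b; rewrite mxE.
have nonneg (i : 'I_k) : 0 <= ((A i)^T *m A i) b b.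
  by rewrite mxE sumr_ge0 // => c _; rewrite mxE -expr2 sqr_ge0.
have /eqP : (\sum_(j < k) (A j)^T *m A j) b b = 0 by rewrite sum0 mxE.
rewrite summxE psumr_eq0 => // /allP/(_ j (mem_index_enum j)) /=.
rewrite mxE psumr_eq0 => [|c _]; last by rewrite mxE -expr2 sqr_ge0.
by move=> /allP/(_ a (mem_index_enum a)); rewrite mxE -expr2 sqrf_eq0 => /eqP.
Qed.

(** By positivity, the row space of the sum of the A_i^T A_i contains the row space
    of each A_i. *)
Lemma sum_tr_mulmx_sub m n k (A : 'I_k -> 'M[rat]_(m, n)) j :
  (A j <= (\sum_(i < k) (A i)^T *m A i)%R)%MS.
Proof.
set C := (\sum_(i < k) (A i)^T *m A i)%R.
rewrite submxE; apply/eqP.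
apply: (@sum_tr_mulmx_eq0 _ _ _ (fun i => A i *m cokermx C) _ j).
rewrite (eq_bigr (fun i => (cokermx C)^T *m ((A i)^T *m A i *m cokermx C))).
  by rewrite -mulmx_sumr -mulmx_suml mulmx_coker mulmx0.
by move=> i _; rewrite trmx_mul !mulmxA.
Qed.

Lemma sum_delta_mulmx N m (g : 'I_N -> 'I_N) (A : 'M[rat]_(N, m)) i j :
  \sum_k (g i == k)%:R * A k j = A (g i) j.
Proof.
rewrite (bigD1 (g i)) //= eqxx mul1r big1 ?addr0 // => k ne.
by rewrite eq_sym (negPf ne) mul0r.
Qed.

Section Filtration.
Variables (G : groupType) (N : nat) (L : couple_lattice G N).
Local Notation act := (lat_act L).
Local Notation le := (lat_le L).
Local Notation meet := (lat_meet L).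
Local Notation fixes := (lat_fixes L).
Local Notation f0 := (lat_top L).
Local Notation orb := (orb L).
Local Notation small := (small L).
Local Notation orb_pos := (orb_pos L).
Local Notation k := (size (orbits L)).

(** The permutation representation on functions on ['I_N], as row vectors:
    [v *m perm_rho g] is the function [x |-> v (g^-1 x)]. *)
Definition perm_rho (g : G) : 'M[rat]_N := \matrix_(x, y) (act g x == y)%:R.
Local Notation rho := perm_rho.

Lemma perm_rho1 : rho 1%g = 1%:M.
Proof. by apply/matrixP => x y; rewrite !mxE lat_act1. Qed.

Lemma perm_rhoM g h : rho (g * h)%g = rho h *m rho g.
Proof.
apply/matrixP => x y; rewrite !mxE lat_actM -[RHS]/(\sum_z _).
under eq_bigr => z _ do rewrite mxE.
by rewrite (sum_delta_mulmx (act h)) mxE.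
Qed.

Lemma perm_rhoT g : (rho g)^T = rho g^-1%g.
Proof.
apply/matrixP => x y; rewrite !mxE; congr (_%:R).
by rewrite -{1}(actVK L g x) (can_eq (actK L g)) eq_sym.
Qed.

Local Notation comm := (comm rho).
Local Notation orthproj := (orthproj rho).

(** The matrices of the commutant are the invariant kernels. *)
Lemma comm_permP T : comm T <-> forall g x y, T (act g x) (act g y) = T x y.
Proof.
have lE g x y : (rho g *m T) x y = T (act g x) y.
  rewrite mxE; under eq_bigr => z _ do rewrite mxE.
  by rewrite (sum_delta_mulmx (act g)).
have rE g x y : (T *m rho g) x (act g y) = T x y.
  rewrite mxE (bigD1 y) //= mxE eqxx mulr1 big1 ?addr0 // => z ne.
  by rewrite mxE (can_eq (actK L g)) (negPf ne) mulr0.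
split=> [cT g x y|cT g]; first by rewrite -lE cT rE.
by apply/matrixP => x y; rewrite -(actVK L g y) lE rE cT.
Qed.

(** The projection onto the functions supported on the orbit of [x]. *)
Definition orb_proj x : 'M[rat]_N := diag_mx (\row_(y < N) (orb x y)%:R).

Lemma orb_projE x (T : 'M[rat]_N) y z : (orb_proj x *m T) y z = (orb x y)%:R * T y z.
Proof. by rewrite mul_diag_mx !mxE. Qed.

Lemma orb_projEr x (T : 'M[rat]_N) y z : (T *m orb_proj x) y z = T y z * (orb x z)%:R.
Proof. by rewrite mul_mx_diag !mxE. Qed.

Lemma orb_proj_orthproj x : orthproj (orb_proj x).
Proof.
split; first exact: tr_diag_mx.
  apply/matrixP => y z; rewrite orb_projE !mxE; case: (orb x y); rewrite ?mul1r //.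
  by rewrite mul0r mul0rn.
by apply/comm_permP => g y z; rewrite !mxE orb_act (can_eq (actK L g)).
Qed.

(** The incidence kernel between the [j]-th small orbit and the top orbit. *)
Definition inc_mx j : 'M[rat]_N :=
  \matrix_(x, f) [&& orb_pos x == j, orb f0 f & le x f]%:R.

Lemma inc_mx_comm j : comm (inc_mx j).
Proof. by apply/comm_permP => g x f; rewrite !mxE orb_pos_act orb_act lat_le_act. Qed.

Lemma inc_mx_orb_proj j : inc_mx j *m orb_proj f0 = inc_mx j.
Proof.
apply/matrixP => x f; rewrite orb_projEr !mxE.
by case: (orb f0 f); rewrite ?mulr1 ?mulr0 // andbF.
Qed.

Lemma inc_mx_top : inc_mx (orb_pos f0) = orb_proj f0.
Proof.
apply/matrixP => x f; rewrite !mxE -mulrnA mulnb.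
rewrite eq_sym orb_pos_orb ?small_top //; congr (_%:R); congr nat_of_bool.
apply/and3P/andP => [[xo fo xf]|[xo /eqP <-]]; last by rewrite xo lat_refl.
split=> //; apply/eqP/(height_eq xf).
by have [[g <-] [h <-]] := (orbP _ _ _ xo, orbP _ _ _ fo); rewrite !height_act.
Qed.

(** Its row space is the [i]-th step of the filtration: the span of the rows of the
    [inc_mx j] with [j < i].  This form of it is symmetric and invariant. *)
Definition gram i : 'M[rat]_N := \sum_(j < i) (inc_mx j)^T *m inc_mx j.

Lemma gram_comm i : comm (gram i).
Proof.
by apply: comm_sum => j _; apply: commM (inc_mx_comm j);
  apply: comm_tr perm_rhoT _ (inc_mx_comm j).
Qed.

Lemma gram_tr i : (gram i)^T = gram i.
Proof.
by rewrite /gram linear_sum /=; apply: eq_bigr => j _; rewrite trmx_mul trmxK.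
Qed.

Lemma inc_mx_gram j i : (j < i)%N -> (inc_mx j <= gram i)%MS.
Proof. move=> ji; exact: (sum_tr_mulmx_sub (fun j : 'I_i => inc_mx j) (Ordinal ji)). Qed.

Lemma gram_le i j : (i <= j)%N -> (gram i <= gram j)%MS.
Proof.
move=> ij; apply: summx_sub => a _; apply: mulmx_sub; apply: inc_mx_gram.
exact: leq_trans ij.
Qed.

Lemma gram_orb_proj i : gram i *m orb_proj f0 = gram i.
Proof.
by rewrite mulmx_suml; apply: eq_bigr => j _; rewrite -mulmxA inc_mx_orb_proj.
Qed.

Lemma row_closed (C : 'M[rat]_N) :
  submod_closed [pred v : 'rV[rat]_N | (v <= C)%MS].
Proof.
by split=> [|a u v]; rewrite !inE ?sub0mx // => uC vC; rewrite addmx_sub ?scalemx_sub.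
Qed.

Lemma row_space_projection (C : 'M[rat]_N) : comm C ->
  exists2 P, orthproj P & forall m (A : 'M_(m, N)), (A <= C)%MS = (A *m P == A).
Proof.
move=> cC; pose S := Submod (row_closed C).
have SE (v : 'rV_N) : (v \in S) = (v <= C)%MS by [].
have [g v|P oP PC] := invariant_projection perm_rhoT (S := S).
  by rewrite !SE => /submxP[D ->]; rewrite -mulmxA -cC mulmxA submxMl.
exists P => // m A; apply/row_subP/eqP => [AC|AP i].
  by apply/row_matrixP => i; rewrite row_mul; apply/eqP; rewrite -PC SE.
by rewrite -SE PC -row_mul AP.
Qed.

(** The orthogonal projection onto the [i]-th step of the filtration. *)
Definition filt_proj i : 'M[rat]_N := s2val (cid2 (row_space_projection (gram_comm i))).

Lemma filt_proj_orthproj i : orthproj (filt_proj i).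
Proof. exact: s2valP. Qed.

Lemma filt_projP i m (A : 'M_(m, N)) : (A <= gram i)%MS = (A *m filt_proj i == A).
Proof. by rewrite (s2valP' (cid2 (row_space_projection (gram_comm i)))). Qed.

Lemma filt_proj_gram i : (filt_proj i <= gram i)%MS.
Proof. by rewrite filt_projP (projI (filt_proj_orthproj i)). Qed.

Lemma filt_proj_le i j : (i <= j)%N -> filt_proj i *m filt_proj j = filt_proj i.
Proof.
by move=> ij; apply/eqP; rewrite -filt_projP (submx_trans (filt_proj_gram i)) ?gram_le.
Qed.

Lemma filt_proj0 : filt_proj 0 = 0.
Proof. 
by apply/eqP; rewrite -submx0; have := filt_proj_gram 0; rewrite /gram big_ord0.
Qed.

Lemma filt_proj_orb_proj i : filt_proj i *m orb_proj f0 = filt_proj i.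
Proof. by have /submxP[D ->] := filt_proj_gram i; rewrite -mulmxA gram_orb_proj. Qed.

Lemma orb_proj_filt_proj i : orb_proj f0 *m filt_proj i = filt_proj i.
Proof.
apply: trmx_inj; rewrite trmx_mul (projT (orb_proj_orthproj f0)).
by rewrite (projT (filt_proj_orthproj i)) filt_proj_orb_proj.
Qed.

Lemma filt_proj_top : filt_proj k = orb_proj f0.
Proof.
rewrite -orb_proj_filt_proj; apply/eqP; rewrite -filt_projP -inc_mx_top inc_mx_gram //.
by rewrite orb_pos_small small_top.
Qed.

(** With C the Gram matrix and P the projection onto its row space, C + 1 - P is
    invertible and its inverse D satisfies D C = P. *)
Lemma filt_proj_factor i : exists2 D, comm D & filt_proj i = D *m gram i.
Proof.
set P := filt_proj i; set C := gram i; have oP : orthproj P := filt_proj_orthproj i.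
have CP : C *m P = C by apply/eqP; rewrite -filt_projP.
have uC : C + 1%:M - P \in unitmx.
  rewrite -row_free_unit; apply: inj_row_free => v v0.
  have vC : v *m C = 0.
    have /(congr1 (mulmx^~ P)) := v0; rewrite mul0mx -mulmxA mulmxBl mulmxDl.
    by rewrite mul1mx (projI oP) addrK CP.
  have vP : v *m P = v.
    move: v0; rewrite mulmxBr mulmxDr mulmx1 vC add0r => /eqP.
    by rewrite subr_eq0 => /eqP.
  have /submxP[w vw] : (v <= C)%MS by rewrite filt_projP vP.
  apply: mulmx_tr_eq0; rewrite {2}vw trmx_mul gram_tr mulmxA vC mul0mx //.
exists (invmx (C + 1%:M - P)).
  apply: comm_inv => //; apply: commB (projC oP).
  by apply: commD; [exact: gram_comm|exact: comm1].
apply: (can_inj (mulKmx uC)); rewrite mulKVmx //.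
by rewrite mulmxBl mulmxDl mul1mx (projI oP) addrK CP.
Qed.

(** An invariant kernel with rows in the [i]-th step is a combination of the
    [inc_mx j], [j < i], with invariant coefficients. *)
Lemma filt_decomposition i T : comm T -> T *m filt_proj i = T ->
  exists2 S : nat -> 'M[rat]_N, (forall j, comm (S j))
    & T = \sum_(j < i) S j *m inc_mx j.
Proof.
move=> cT Ti; have [D cD PD] := filt_proj_factor i.
exists (fun j => T *m D *m (inc_mx j)^T) => [j|].
  by apply: commM (comm_tr perm_rhoT (inc_mx_comm j)); apply: commM.
rewrite -{1}Ti PD mulmxA mulmx_sumr.
by apply: eq_bigr => j _; rewrite mulmxA.
Qed.

(** The orthogonal projection onto the complement of the [i]-th step of the
    filtration in the next one. *)
Definition layer i : 'M[rat]_N := filt_proj i.+1 - filt_proj i.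

Lemma layer_orthproj i : orthproj (layer i).
Proof.
by apply: orthprojB (filt_proj_orthproj _) (filt_proj_orthproj _) _; rewrite filt_proj_le.
Qed.

Lemma layer_filt_proj i : layer i *m filt_proj i.+1 = layer i.
Proof. by rewrite mulmxBl filt_proj_le // filt_proj_le. Qed.

Lemma layer_orb_proj i : layer i *m orb_proj f0 = layer i.
Proof. by rewrite mulmxBl !filt_proj_orb_proj. Qed.

Lemma orb_proj_layer i : orb_proj f0 *m layer i = layer i.
Proof. by rewrite mulmxBr !orb_proj_filt_proj. Qed.

Lemma layer_mul_lt i j : (i < j)%N -> layer i *m layer j = 0.
Proof.
move=> ij; rewrite /layer mulmxBl !mulmxBr.
by rewrite !filt_proj_le ?subrr //; [exact: ltnW|exact: leqW (ltnW ij)|exact: leqW].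
Qed.

Lemma layer_mul i j : i != j -> layer i *m layer j = 0.
Proof.
rewrite neq_ltn => /orP[|ji]; first exact: layer_mul_lt.
apply: trmx_inj; rewrite trmx_mul trmx0.
by rewrite (projT (layer_orthproj i)) (projT (layer_orthproj j)) layer_mul_lt.
Qed.

Lemma sum_layer : \sum_(i < k) layer i = orb_proj f0.
Proof.
by rewrite -(big_mkord xpredT layer) telescope_sumr // filt_proj0 subr0 filt_proj_top.
Qed.

End Filtration.

(** * Kernels counting embeddings *)
Section Kernels.
Variables (G : groupType) (N : nat) (L : couple_lattice G N).
Local Notation act := (lat_act L).
Local Notation le := (lat_le L).
Local Notation meet := (lat_meet L).
Local Notation fixes := (lat_fixes L).
Local Notation f0 := (lat_top L).
Local Notation orb := (orb L).
Local Notation small := (small L).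
Local Notation orb_pos := (orb_pos L).
Local Notation k := (size (orbits L)).
Local Notation rho := (perm_rho L).
Local Notation comm := (comm rho).
Local Notation orthproj := (orthproj rho).
Local Notation orb_proj := (orb_proj L).
Local Notation inc_mx := (inc_mx L).
Local Notation filt_proj := (filt_proj L).
Local Notation layer := (layer L).
Local Notation height := (height L).

(** The zeta matrix of the poset, which is invertible: Moebius inversion. *)
Definition zeta : 'M[rat]_N := \matrix_(z, x) (le z x)%:R.

Lemma zeta_unit : zeta \in unitmx.
Proof.
rewrite -row_free_unit; apply: inj_row_free => v v0.
apply/rowP => x; rewrite [RHS]mxE.
have [n] := ubnP (height x); elim: n => // n IH in x *; rewrite ltnS => hx.
have /rowP/(_ x) := v0; rewrite !mxE (bigD1 x) //= mxE lat_refl mulr1.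
rewrite big1 ?addr0 // => z zx; rewrite mxE.
case: (boolP (le z x)) => lzx; last by rewrite mulr0.
rewrite IH ?mul0r //; apply: leq_trans hx; rewrite ltn_neqAle le_height // andbT.
by apply: contraNneq zx => hzx; apply/eqP/(height_eq lzx).
Qed.

Lemma zetaE (v : 'rV[rat]_N) x : (v *m zeta) 0 x = \sum_(z | le z x) v 0 z.
Proof.
rewrite mxE [RHS]big_mkcond; apply: eq_bigr => z _.
by rewrite mxE mulr_natr mulrb.
Qed.

Lemma moebius (g : 'I_N -> rat) : exists g' : 'I_N -> rat,
  forall x, g x = \sum_(z | le z x) g' z.
Proof.
exists (fun z => ((\row_x g x) *m invmx zeta) 0 z) => x.
by rewrite -zetaE mulmxKV ?zeta_unit // mxE.
Qed.

(** Moebius inversion on the interval below [x0]. *)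
Lemma moebius_inj x0 (g : 'I_N -> rat) :
  (forall x, le x x0 -> \sum_(z | le z x) g z = 0) ->
  forall x, le x x0 -> g x = 0.
Proof.
move=> g0; pose v := \row_(z < N) (if le z x0 then g z else 0).
have v0 : v = 0.
  apply: (can_inj (mulmxK zeta_unit)); rewrite mul0mx; apply/rowP => x.
  rewrite zetaE [RHS]mxE -[RHS](g0 (meet x x0) (meetr _ _ _)).
  rewrite big_mkcond [RHS]big_mkcond; apply: eq_bigr => z _.
  by rewrite lat_leI mxE; case: (le z x); case: (le z x0).
by move=> x xx0; have /rowP/(_ x) := v0; rewrite !mxE xx0.
Qed.

(** The fiber over [x0]: the pairs [(x0, f')] with [f'] in the top orbit, up to the
    stabilizer of [x0]. *)
Section Fiber.
Variable x0 : 'I_N.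
Hypothesis x0_small : small x0.

(** Conjugacy under the stabilizer of [x0]; for [y], [z] below [x0] it says that
    their embeddings in [x0] are equivalent. *)
Definition sim y z := `[< exists g, act g x0 = x0 /\ act g y = z >].

Lemma simP y z : reflect (exists g, act g x0 = x0 /\ act g y = z) (sim y z).
Proof. exact: asboolP. Qed.

Lemma sim_refl y : sim y y.
Proof. by apply/simP; exists 1%g; rewrite !lat_act1. Qed.

Lemma stabV g : act g x0 = x0 -> act g^-1%g x0 = x0.
Proof. by move=> gx; rewrite -{1}gx actK. Qed.

Lemma sim_act g y z : act g x0 = x0 -> sim y (act g z) = sim y z.
Proof.
move=> gx; apply/simP/simP => -[h [hx hy]].
  by exists (g^-1 * h)%g; rewrite !lat_actM hx hy actK stabV.
by exists (g * h)%g; rewrite !lat_actM hx hy gx.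
Qed.

Lemma sim_sym y z : sim y z = sim z y.
Proof.
by apply/simP/simP => -[g [gx <-]]; exists g^-1%g; rewrite actK stabV.
Qed.

Lemma sim_trans x y z : sim x y -> sim y z = sim x z.
Proof.
by move=> /simP[g [gx <-]]; rewrite sim_sym sim_act // sim_sym.
Qed.

Lemma sim_le y z : sim y z -> le y x0 -> le z x0.
Proof. by move=> /simP[g [gx <-]]; rewrite -{2}gx lat_le_act. Qed.

Lemma sim_orb_pos y z : sim y z -> orb_pos z = orb_pos y.
Proof. by move=> /simP[g [gx <-]]; rewrite orb_pos_act. Qed.

(** The canonical representative of the class of [y] for [sim]. *)
Definition srep y := odflt y [pick z | sim y z].

Lemma sim_srep y : sim y (srep y).
Proof. by rewrite /srep; case: pickP => //= /(_ y); rewrite sim_refl. Qed.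

Lemma srep_eq x y : sim x y -> srep x = srep y.
Proof.
move=> xy; rewrite /srep (eq_pick (Q := sim y)) => [|z /=].
  by case: pickP => //= /(_ y); rewrite sim_refl.
by rewrite (sim_trans _ xy).
Qed.

(** One element in each class of elements below [x0]. *)
Definition sreps := [set y | le y x0 & srep y == y].

Lemma sreps_le y : y \in sreps -> le y x0.
Proof. by rewrite inE => /andP[]. Qed.

Lemma sreps_sim y z : y \in sreps -> z \in sreps -> sim y z = (z == y).
Proof.
rewrite !inE => /andP[_ /eqP ey] /andP[_ /eqP ez].
apply/idP/eqP => [/srep_eq|->]; last exact: sim_refl.
by rewrite ey ez.
Qed.

Lemma srep_sreps y : le y x0 -> srep y \in sreps.
Proof.
move=> yx; rewrite inE (sim_le (sim_srep y) yx).
by rewrite -(srep_eq (sim_srep y)) eqxx.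
Qed.

Lemma sum_sreps (a : 'I_N -> rat) z : le z x0 ->
  \sum_(y in sreps) a y * (sim y z)%:R = a (srep z).
Proof.
move=> zx; rewrite (bigD1 (srep z)) ?srep_sreps //= sim_sym sim_srep mulr1.
rewrite big1 ?addr0 // => y /andP[ys ne].
rewrite sim_sym (_ : sim z y = sim (srep z) y).
  by rewrite sreps_sim ?srep_sreps // (negPf ne) mulr0.
by rewrite (sim_trans _ (sim_srep z)).
Qed.

(** Representatives of the fiber over [x0]: for every [z] below [x0], a move of one
    [f] in the top orbit that fixes [z] and meets [x0] in [z]. *)
Lemma top_fiber : exists f (alpha : 'I_N -> G), orb f0 f /\
  (forall z, le z x0 -> fixes (alpha z) z /\ meet (act (alpha z) f) x0 = z).
Proof.
have /existsP[f /andP[f0f x0f]] := x0_small.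
have /choice[alpha alphaP] : forall z, exists a, le z x0 ->
    fixes a z /\ meet (act a f) x0 = z.
  move=> z; have [zx|nzx] := boolP (le z x0); last by exists 1%g.
  have /orbP[g gf] := f0f; rewrite -gf in x0f *.
  by have [a az am] := lat_meet_all zx x0f; exists a.
by exists f, alpha.
Qed.

Section Evaluation.
Variables (f : 'I_N) (alpha : 'I_N -> G).
Hypothesis f0f : orb f0 f.
Hypothesis alphaP : forall z, le z x0 ->
  fixes (alpha z) z /\ meet (act (alpha z) f) x0 = z.

Lemma glue_eq w w' x g : act g w = w' -> fixes g (meet w x) ->
  meet w' x = meet w x -> exists h, act h x = x /\ act h w = w'.
Proof. by move=> <- fg mw; exact: lat_glue. Qed.

(** A pair [(x0, f')] is determined, up to the group, by the meet of [f'] and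
    [x0]. *)
Lemma normal_position f' : orb f0 f' ->
  exists h, act h x0 = x0 /\ act h f' = act (alpha (meet f' x0)) f.
Proof.
move=> f0f'; set z := meet f' x0.
have zx : le z x0 by apply: meetr.
have [az mz] := alphaP zx.
have /orbP[g gf'] := f0f'.
have /orbP[h hf] : orb f0 (act (alpha z) f) by rewrite orb_act.
have zf' : le z (act g f0) by rewrite gf' meetl.
have zaf : le z (act h f0) by rewrite hf -{1}mz meetl.
have [b bz] := lat_homog zf' zaf; rewrite gf' hf => bE.
exact: glue_eq bE bz mz.
Qed.

(** An invariant kernel is thus determined by its values at [(x0, alpha z f)]. *)
Lemma kernel_eq0 T : comm T -> orb_proj x0 *m T = T -> T *m orb_proj f0 = T ->
  (forall z, le z x0 -> T x0 (act (alpha z) f) = 0) -> T = 0.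
Proof.
move=> /comm_permP cT Tx Tf T0; apply/matrixP => x f'; rewrite [RHS]mxE.
have [/orbP[g <-]|nx] := boolP (orb x0 x); last first.
  by rewrite -Tx orb_projE (negPf nx) mul0r.
have [f0f'|nf] := boolP (orb f0 f'); last first.
  by rewrite -Tf orb_projEr (negPf nf) mulr0.
rewrite -(actVK L g f') cT; set f'' := act _ f'.
have [h [hx hf]] := @normal_position f'' (etrans (orb_act _ _ _ _) f0f').
by rewrite -(cT h) hx hf T0 ?meetr.
Qed.

Lemma kernel_stab T z h : comm T -> le z x0 -> act h x0 = x0 ->
  T x0 (act (alpha (act h z)) f) = T x0 (act (alpha z) f).
Proof.
move=> /comm_permP cT zx hx; have [_ mz] := alphaP zx.
have [|g [gx gf]] := @normal_position (act h (act (alpha z) f)).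
  by rewrite !orb_act.
have mhz : meet (act h (act (alpha z) f)) x0 = act h z.
  by rewrite -{1}hx -act_meet mz.
by rewrite -[RHS](cT h) hx -[RHS](cT g) gx gf mhz.
Qed.

(** The indicator of the pairs [(x, z)] conjugate to [(x0, y)]. *)
Definition emb_mx y : 'M[rat]_N :=
  \matrix_(x, z) `[< exists g, act g x0 = x /\ act g y = z >]%:R.

(** Its value at [(x, f')], with [f'] in the top orbit, is the number of [z] below
    [x] and [f'] such that [z] sits in [x] as [y] sits in [x0]. *)
Definition emb_ker y : 'M[rat]_N := emb_mx y *m inc_mx (orb_pos y).

Lemma emb_ker_comm y : comm (emb_ker y).
Proof.
apply: commM (inc_mx_comm _ _); apply/comm_permP => g x z; rewrite !mxE.
congr (_%:R); congr nat_of_bool; apply/asboolP/asboolP => -[h [hx hy]].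
  by exists (g^-1 * h)%g; rewrite !lat_actM hx hy !actK.
by exists (g * h)%g; rewrite !lat_actM hx hy.
Qed.

Lemma emb_ker_orb_proj y : orb_proj x0 *m emb_ker y = emb_ker y.
Proof.
rewrite mulmxA; congr (_ *m _); apply/matrixP => x z; rewrite orb_projE mxE.
case: asboolP => [[g [<- _]]|]; last by rewrite mulr0.
by rewrite orb_act orb_refl mulr1.
Qed.

Lemma emb_ker_filt_proj y i : (orb_pos y < i)%N -> emb_ker y *m filt_proj i = emb_ker y.
Proof.
move=> lt_y; apply/eqP; rewrite -filt_projP; apply: mulmx_sub.
exact: inc_mx_gram.
Qed.

Lemma emb_ker_orb_projr y : emb_ker y *m orb_proj f0 = emb_ker y.
Proof. by rewrite -mulmxA inc_mx_orb_proj. Qed.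

Lemma emb_ker_eval y z : le y x0 -> le z x0 ->
  emb_ker y x0 (act (alpha z) f) = \sum_(w | le w z) (sim y w)%:R.
Proof.
move=> yx zx; have [_ mz] := alphaP zx.
rewrite mxE [RHS]big_mkcond; apply: eq_bigr => w _; rewrite mxE -/(sim y w).
case: (boolP (sim y w)) => yw; last by rewrite mul0r if_same.
rewrite mul1r mxE (sim_orb_pos yw) eqxx orb_act f0f /=.
rewrite -[X in if le w X then _ else _]mz lat_leI (sim_le yw yx) andbT.
by case: (le w _).
Qed.

Lemma emb_ker_free (a : 'I_N -> rat) :
  \sum_(y in sreps) a y *: emb_ker y = 0 -> forall y, y \in sreps -> a y = 0.
Proof.
move=> sum0 y ys; have yx := sreps_le ys.
(* the Moebius transform of the evaluated combination is [z |-> a (srep z)] *)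
suff /(_ y yx) : forall z, le z x0 -> a (srep z) = 0.
  by move: ys; rewrite inE => /andP[_ /eqP ->].
move=> z zx; rewrite -sum_sreps //; move: z zx.
apply: moebius_inj => z zx; rewrite exchange_big /=.
have /matrixP/(_ x0 (act (alpha z) f)) := sum0; rewrite summxE [RHS]mxE => e0.
rewrite -[RHS]e0.
apply: eq_bigr => w ws; rewrite mxE emb_ker_eval ?(sreps_le ws) //.
by rewrite mulr_sumr.
Qed.

(** The Moebius transform [A] of an invariant kernel that factors through the [j]-th
    orbit is supported on elements below some member of that orbit, whose position
    is therefore at most [j]. *)
Lemma inc_mx_eval j S : comm S -> exists A : 'I_N -> rat,
  (forall z, A z != 0 -> (orb_pos z <= j)%N) /\
  forall z, le z x0 -> (S *m inc_mx j) x0 (act (alpha z) f) = \sum_(w | le w z) A w.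
Proof.
move=> /comm_permP cS.
(* for each [w], invert [u |-> S x0 (act (alpha u) w)] *)
have /choice[g' g'P] : forall w, exists g' : 'I_N -> rat, forall u,
    S x0 (act (alpha u) w) = \sum_(v | le v u) g' v.
  by move=> w; exact: moebius.
exists (fun v => \sum_(w | [&& orb_pos w == j, le w f & le v w]) g' w v); split.
  move=> v; apply: contraNT; rewrite -ltnNge => lt_j; rewrite big_pred0 // => w.
  apply/negP => /and3P[/eqP cw wf vw]; move: lt_j; rewrite ltnNge -cw orb_pos_le //.
  by apply: small_le wf _; apply/existsP; exists f; rewrite f0f lat_refl.
move=> z zx; have [az mz] := alphaP zx.
rewrite mxE (reindex_inj (can_inj (actK L (alpha z)))) /=.
rewrite (exchange_big_dep (fun w => (orb_pos w == j) && le w f)) /=; last first.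
  by move=> v w _ /and3P[-> ->].
rewrite [RHS]big_mkcond; apply: eq_bigr => w _.
rewrite mxE orb_pos_act orb_act f0f lat_le_act /=.
case: ifP => [/andP[cw wf]|_]; last by rewrite mulr0.
rewrite mulr1; under eq_bigl => v do rewrite cw wf.
(* [act (alpha z) w] may be replaced by [act (alpha u) w] for [u] the meet of [w]
   and [z]: both meet [x0] in [u], so the pairs they form with [x0] are glued *)
have mw : meet (act (alpha z) w) x0 = meet w z.
  apply: (@le_ext _ _ L) => u; rewrite !lat_leI; apply/andP/andP => -[uw ux].
    have uz : le u z by rewrite -mz lat_leI ux andbT (lat_trans uw) // lat_le_act.
    by rewrite -(lat_le_act L (alpha z)) (lat_fixes_act az uz).
  by rewrite -{1}(lat_fixes_act az ux) lat_le_act uw (lat_trans ux zx).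
set u := meet w z; have ux : le u x0 by apply: lat_trans zx; apply: meetr.
have [au mu] := alphaP ux.
have [|||h [hx hw]] := @glue_eq (act (alpha z) w) (act (alpha u) w) x0
    (alpha u * (alpha z)^-1)%g.
- by rewrite lat_actM actK.
- rewrite mw; apply: lat_fixesM => //; apply: lat_fixesV; apply: lat_fixes_le az _.
  exact: meetr.
- rewrite mw; apply: (@le_ext _ _ L) => v; rewrite !lat_leI; apply/andP/andP => -[vw vz].
    have vu : le v u by rewrite -mu lat_leI vz andbT (lat_trans vw) // lat_le_act.
    by apply/andP; rewrite -lat_leI.
  have vu : le v u by rewrite lat_leI vw vz.
  by rewrite -{1}(lat_fixes_act au vu) lat_le_act vw (lat_trans vz zx).
rewrite -(cS h) hx hw g'P; apply: eq_bigl => v; rewrite lat_leI andbC.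
by [].
Qed.

(** The coefficients are the Moebius transform of the values of [T] at the pairs
    [(x0, alpha z f)]; it is constant on the classes of [sim], by uniqueness. *)
Lemma emb_ker_span i T : comm T -> orb_proj x0 *m T = T -> T *m filt_proj i = T ->
  exists a, T = \sum_(y in sreps | (orb_pos y < i)%N) a y *: emb_ker y.
Proof.
move=> cT Tx Ti; have [S cS TS] := filt_decomposition cT Ti.
have /choice[B BP] : forall j : 'I_i, exists A : 'I_N -> rat,
    (forall z, A z != 0 -> (orb_pos z <= j)%N) /\
    forall z, le z x0 -> (S j *m inc_mx j) x0 (act (alpha z) f) = \sum_(w | le w z) A w.
  by move=> j; apply: inc_mx_eval.
pose A z := \sum_j B j z.
have A0 z : A z != 0 -> (orb_pos z < i)%N.
  apply: contraNT; rewrite -leqNgt => iz; rewrite /A big1 // => j _.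
  apply/eqP; apply: contraTT iz => /(proj1 (BP j)) zj; rewrite -ltnNge.
  exact: leq_ltn_trans zj (ltn_ord j).
have TA z : le z x0 -> T x0 (act (alpha z) f) = \sum_(w | le w z) A w.
  move=> zx; rewrite exchange_big /= {1}TS summxE; apply: eq_bigr => j _.
  by rewrite (proj2 (BP j)).
have Asim h z : act h x0 = x0 -> le z x0 -> A (act h z) = A z.
  move=> hx zx; apply/eqP; rewrite -subr_eq0; apply/eqP.
  move: z zx; apply: moebius_inj => z zx; rewrite sumrB -TA //.
  have hzx : le (act h z) x0 by rewrite -hx lat_le_act.
  rewrite -(kernel_stab cT zx hx) TA //.
  rewrite [X in _ - X](reindex_inj (can_inj (actK L h))) /=.
  by under [X in _ - X]eq_bigl => w do rewrite lat_le_act; rewrite subrr.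
exists A; apply/eqP; rewrite -subr_eq0; apply/eqP.
have EA : \sum_(y in sreps | (orb_pos y < i)%N) A y *: emb_ker y =
          \sum_(y in sreps) A y *: emb_ker y.
  rewrite big_mkcondr /=; apply: eq_bigr => y _; case: ifP => // /negbT ny.
  by rewrite (_ : A y = 0) ?scale0r //; apply/eqP; apply: contraNT ny => /A0.
rewrite EA; apply: kernel_eq0.
- apply: commB => //; apply: comm_sum => y _; apply: commZ.
  exact: emb_ker_comm.
- rewrite mulmxBr Tx mulmx_sumr; congr (_ - _); apply: eq_bigr => y _.
  by rewrite -scalemxAr emb_ker_orb_proj.
- rewrite mulmxBl -{1}Ti -mulmxA filt_proj_orb_proj Ti mulmx_suml; congr (_ - _).
  by apply: eq_bigr => y _; rewrite -scalemxAl emb_ker_orb_projr.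
move=> z zx; rewrite !mxE summxE TA //.
under [X in _ - X]eq_bigr => y ys do
  rewrite mxE emb_ker_eval ?(sreps_le ys) // mulr_sumr.
rewrite [X in _ - X]exchange_big /= -sumrB big1 // => w wz.
have wx := lat_trans wz zx.
rewrite sum_sreps //; have /simP[h [hx <-]] := sim_srep w.
by rewrite Asim // subrr.
Qed.

(** The [emb_ker y] with [y] in the [i]-th orbit, multiplied by [layer i], form a
    basis of the space of homomorphisms. *)
Lemma hom_space_layer_dim i : (i < k)%N ->
  \dim (hom_space rho (orb_proj x0) (layer i)) = #|[set y in sreps | orb_pos y == i]|.
Proof.
move=> ltik; set Y := [set y in sreps | orb_pos y == i].
pose Ph (a : 'rV[rat]_#|Y|) : 'M[rat]_N :=
  \sum_j a 0 j *: (emb_ker (enum_val j) *m layer i).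
have Phl : linear Ph.
  move=> c a b; rewrite /Ph scaler_sumr -big_split; apply: eq_bigr => j _ /=.
  by rewrite !mxE scalerDl scalerA.
have YP y : y \in Y -> y \in sreps /\ orb_pos y = i by rewrite inE => /andP[-> /eqP].
have sumY (a : 'I_N -> rat) (F : 'I_N -> 'M[rat]_N) :
    \sum_(y in Y) a y *: F y = \sum_(y in sreps | orb_pos y == i) a y *: F y.
  by apply: eq_bigl => y; rewrite inE.
have layer_lt y : (orb_pos y < i)%N -> emb_ker y *m layer i = 0.
  by move=> lt_y; rewrite mulmxBr !emb_ker_filt_proj ?subrr // ltnW.
have Pinj a : Ph a = 0 -> a = 0.
  move=> Pa0; pose a' y := \sum_(j | enum_val j == y) a 0 j.
  have a'E j : a' (enum_val j) = a 0 j.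
    rewrite /a' (eq_bigl (pred1 j)) ?big_pred1_eq // => u.
    by rewrite (inj_eq enum_val_inj).
  pose T := \sum_(y in Y) a' y *: emb_ker y.
  have T0 : T *m layer i = 0.
    rewrite -Pa0 /T big_enum_val mulmx_suml; apply: eq_bigr => j _.
    by rewrite a'E scalemxAl.
  have cT : comm T by apply: comm_sum => y _; apply: commZ; apply: emb_ker_comm.
  have Tx : orb_proj x0 *m T = T.
    by rewrite mulmx_sumr; apply: eq_bigr => y _; rewrite -scalemxAr emb_ker_orb_proj.
  have Ti1 : T *m filt_proj i.+1 = T.
    rewrite mulmx_suml; apply: eq_bigr => y /YP[_ cy].
    by rewrite -scalemxAl emb_ker_filt_proj ?cy.
  have Ti : T *m filt_proj i = T.
    by move/eqP: T0; rewrite mulmxBr Ti1 subr_eq0 => /eqP <-.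
  have [b Tb] := emb_ker_span cT Tx Ti.
  (* [T] is also a combination of the [emb_ker y] with [orb_pos y < i]: subtract *)
  pose c y := (if (orb_pos y < i)%N then b y else 0) -
    (if orb_pos y == i then a' y else 0).
  have c0 : \sum_(y in sreps) c y *: emb_ker y = 0.
    under eq_bigr => y _ do rewrite scalerBl.
    apply/eqP; rewrite sumrB subr_eq0; apply/eqP; transitivity T.
      rewrite Tb big_mkcondr; apply: eq_bigr => y _.
      by case: ifP => // _; rewrite scale0r.
    rewrite /T sumY big_mkcondr; apply: eq_bigr => y _.
    by case: ifP => // _; rewrite scale0r.
  apply/rowP => j; rewrite mxE -a'E.
  have [ys cy] := YP _ (enum_valP j).
  by have /eqP := emb_ker_free c0 ys; rewrite /c cy ltnn eqxx sub0r oppr_eq0 => /eqP.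
pose h := linfun (linear_of Phl).
have -> : hom_space rho (orb_proj x0) (layer i) = (h @: fullv)%VS.
  apply/vspaceP => T; apply/hom_spaceP/memv_imgP => [[cT Tx Ti]|[a _ ->]].
    have Ti1 : T *m filt_proj i.+1 = T by rewrite -Ti -mulmxA layer_filt_proj.
    have [a Ta] := emb_ker_span cT Tx Ti1.
    exists (\row_j a (enum_val j)); first exact: memvf.
    rewrite lfunE /= -Ti {1}Ta mulmx_suml.
    under [RHS]eq_bigr => j _ do rewrite mxE.
    rewrite -(big_enum_val (fun y => a y *: (emb_ker y *m layer i))) sumY.
    rewrite big_mkcondr [RHS]big_mkcondr; apply: eq_bigr => y _.
    rewrite ltnS leq_eqVlt; case: eqP => [_|_] /=; first by rewrite scalemxAl.
    by case: ifP => // lt_y; rewrite -scalemxAl layer_lt ?scaler0.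
  rewrite lfunE /=; split.
  - apply: comm_sum => j _; apply: commZ; apply: commM (emb_ker_comm _) _.
    exact: projC (layer_orthproj _ _).
  - rewrite mulmx_sumr; apply: eq_bigr => j _.
    by rewrite -scalemxAr mulmxA emb_ker_orb_proj.
  - rewrite mulmx_suml; apply: eq_bigr => j _.
    by rewrite -scalemxAl -mulmxA (projI (layer_orthproj _ _)).
rewrite limg_dim_eq ?dimvf ?dim_matrix ?mul1r //.
apply/eqP; rewrite capfv -subv0; apply/subvP => a.
by rewrite memv_ker lfunE /= => /eqP/Pinj ->; rewrite mem0v.
Qed.

End Evaluation.
End Fiber.

Lemma hom_space_orb_proj_dim x0 i : small x0 -> (i < k)%N ->
  \dim (hom_space rho (orb_proj x0) (layer i)) = #|[set y in sreps x0 | orb_pos y == i]|.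
Proof.
move=> sx lti; have [f [alpha [f0f alphaP]]] := top_fiber sx.
exact: hom_space_layer_dim f0f alphaP _ lti.
Qed.

(** Below an element of the top orbit, elements of the same type are conjugate under
    its stabilizer, by the symmetry of [phi]: one class for each type. *)
Lemma top_fiber1 i : (i < k)%N -> #|[set y in sreps f0 | orb_pos y == i]| = 1%N.
Proof.
move=> lti; set x := nth f0 (orbits L) i.
have cx : orb_pos x = i := orb_pos_nth lti.
have sx : small x by rewrite -orb_pos_small cx.
have /existsP[f /andP[/orbP[g gf] xf]] := sx.
pose y := srep f0 (act g^-1%g x).
have yf : le (act g^-1%g x) f0 by rewrite -(lat_le_act L g) actVK gf.
(* move [z] to [w] by [h], then bring back [act h f0], which is above [w], to [f0]
   while [w] is fixed *)
have simE z w : le z f0 -> le w f0 -> orb_pos z = orb_pos w -> sim f0 z w.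
  move=> zf wf /eqP; rewrite orb_pos_orb => [/orbP[h hz]|]; last first.
    exact: small_le zf (small_top _).
  have wh : le w (act h f0) by rewrite -hz lat_le_act.
  have w1 : le w (act 1%g f0) by rewrite lat_act1.
  have [b bw] := lat_homog wh w1; rewrite lat_act1 => bf.
  apply/simP; exists (b * h)%g; rewrite !lat_actM hz; split=> //.
  exact: lat_fixes_act bw (lat_refl _ _).
have cy : orb_pos y = i by rewrite (sim_orb_pos (sim_srep _ _)) orb_pos_act.
apply/eqP/cards1P; exists y; apply/setP => z; rewrite !inE.
apply/andP/eqP => [[/andP[zf /eqP ez] /eqP cz]|->].
  rewrite -ez; apply: srep_eq; apply: simE => //.
  by rewrite orb_pos_act cx.
by rewrite cy eqxx; have := srep_sreps yf; rewrite inE => ->.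
Qed.

Lemma layer_neq0 i : (i < k)%N -> layer i != 0.
Proof.
move=> lti; apply/eqP => g0; have := hom_space_orb_proj_dim (small_top L) lti.
rewrite top_fiber1 // (_ : hom_space _ _ _ = 0%VS) ?dimv0 //.
apply/eqP; rewrite -subv0; apply/subvP => T /hom_spaceP[_ _ <-].
by rewrite g0 mulmx0 mem0v.
Qed.

(** The homomorphisms from the functions on the top orbit to the [i]-th layer form
    a line. *)
Lemma mul_layer_scalar i T : (i < k)%N -> comm T ->
  exists c, orb_proj f0 *m T *m layer i = c *: layer i.
Proof.
move=> lti cT; have gin : layer i \in hom_space rho (orb_proj f0) (layer i).
  apply/hom_spaceP; split; [exact: projC (layer_orthproj _ _)|exact: orb_proj_layer|].
  exact: projI (layer_orthproj _ _).
have : hom_space rho (orb_proj f0) (layer i) = <[layer i]>%VS.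
  apply/esym/eqP; rewrite eqEdim -memvE gin dim_vline layer_neq0 //=.
  by rewrite hom_space_orb_proj_dim ?small_top ?top_fiber1.
move=> homE; apply/vlineP; rewrite -homE; apply/hom_spaceP; split.
- apply: commM (projC (layer_orthproj _ _)).
  exact: commM (projC (orb_proj_orthproj _ _)) cT.
- by rewrite !mulmxA (projI (orb_proj_orthproj _ _)).
- by rewrite -mulmxA (projI (layer_orthproj _ _)).
Qed.

Lemma layer_scalar i T : (i < k)%N -> comm T ->
  exists c, layer i *m T *m layer i = c *: layer i.
Proof.
move=> lti cT; have [c cE] := mul_layer_scalar lti cT; exists c.
rewrite -{1}(layer_orb_proj L i) -!mulmxA (mulmxA (orb_proj f0)) cE -scalemxAr.
by rewrite (projI (layer_orthproj _ _)).
Qed.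

Lemma layer_hom0 i j T : (j < k)%N -> i != j -> comm T -> layer i *m T *m layer j = 0.
Proof.
move=> ltj ij cT; have [c cE] := mul_layer_scalar ltj cT.
rewrite -{1}(layer_orb_proj L i) -!mulmxA (mulmxA (orb_proj f0)) cE -scalemxAr.
by rewrite layer_mul // scaler0.
Qed.

Local Notation im_rep := (im_rep (perm_rho1 L) (perm_rhoM L)).

(** * The constituents *)

(** The representation attached to the [i]-th type below [phi]. *)
Definition constituent i : rep G := im_rep (layer_orthproj L i).

Lemma constituent_irreducible i : (i < k)%N -> irreducible (constituent i).
Proof.
move=> lti; apply: im_rep_irreducible (perm_rhoT L) _ _ _ _.
  exact: layer_neq0.
by move=> T; exact: layer_scalar.
Qed.

Lemma constituent_inj i j : (i < k)%N -> (j < k)%N ->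
  rep_iso (constituent i) (constituent j) -> i = j.
Proof.
move=> lti ltj [f [bf fG]]; apply/eqP; apply: contraTT isT => ij.
have [T [cT iT Tj fT]] := im_hom_matrix fG.
have T0 : T = 0 by rewrite -Tj -iT layer_hom0.
have [v v0] := im_rep_neq0 (perm_rho1 L) (perm_rhoM L)
  (layer_orthproj L i) (layer_neq0 lti).
case: v0; apply: (bij_inj bf); apply: val_inj.
by rewrite fT T0 mulmx0 linear0.
Qed.

Lemma mul_layer_sum (i : 'I_k) (r : seq 'I_k) : i \notin r ->
  layer i *m (\sum_(j <- r) layer j) = 0.
Proof.
move=> ir; rewrite mulmx_sumr big_seq big1 // => j jr; apply: layer_mul.
by apply: contraNneq ir => /val_inj ->.
Qed.

Lemma sum_layer_orthproj (r : seq 'I_k) : uniq r -> orthproj (\sum_(j <- r) layer j).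
Proof.
elim: r => [_|i r IH /= /andP[ir ur]]; first by rewrite big_nil; exact: orthproj0.
rewrite big_cons; apply: orthprojD (layer_orthproj _ _) (IH ur) _.
exact: mul_layer_sum.
Qed.

Lemma constituent_sum (V : rep G) : rep_iso V (im_rep (orb_proj_orthproj L f0)) ->
  rep_iso V (rep_bigsum [seq constituent i | i : 'I_k <- enum 'I_k]).
Proof.
move=> /rep_iso_trans; apply.
suff gen (r : seq 'I_k) (p : 'M[rat]_N) (op : orthproj p) : uniq r ->
    p = \sum_(i <- r) layer i ->
    rep_iso (im_rep op) (rep_bigsum [seq constituent i | i : 'I_k <- r]).
  by apply: gen; [exact: enum_uniq|rewrite big_enum sum_layer].
elim: r p op => [|i r IH] p op /=.
  by move=> _; rewrite big_nil => p0; exact: im_rep_zero.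
move=> /andP[ir ur]; rewrite big_cons => pE; have oq := sum_layer_orthproj ur.
apply: rep_iso_trans (rep_iso_dsum (rep_iso_refl _) (IH _ oq ur erefl)).
exact: im_rep_dsum pE (mul_layer_sum ir).
Qed.

Lemma constituent_multiplicity x0 i (V : rep G) : small x0 -> (i < k)%N ->
  rep_iso V (im_rep (orb_proj_orthproj L x0)) ->
  multiplicity (constituent i) V #|[set y in sreps x0 | orb_pos y == i]|.
Proof.
move=> sx lti isoV; rewrite -hom_space_orb_proj_dim //.
apply: im_rep_multiplicity isoV; first exact: perm_rhoT.
by move=> T; exact: layer_scalar.
Qed.

Lemma card_sreps_self x : small x ->
  #|[set y in sreps x | orb_pos y == orb_pos x]| = 1%N.
Proof.
move=> sx; apply/eqP/cards1P; exists x; apply/setP => y; rewrite !inE.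
apply/andP/eqP => [[/andP[yx _]]|->].
  rewrite eq_sym orb_pos_orb // => /orbP[g gx]; apply: (height_eq yx).
  by rewrite -gx height_act.
split=> //; rewrite lat_refl; have /simP[g [gx <-]] := sim_srep x x.
by rewrite gx eqxx.
Qed.

End Kernels.

(** * Submodules, isomorphisms and automorphisms *)
Lemma inj_surj_bijective (A B : Type) (f : A -> B) :
  injective f -> (forall y, exists x, f x = y) -> bijective f.
Proof.
move=> fI fS; pose g y := projT1 (cid (fS y)).
have gK y : f (g y) = y by rewrite /g; case: cid.
by exists g => // x; apply: fI; rewrite gK.
Qed.

Section SubmoduleTools.
Variable R : pzRingType.
Implicit Types M N : lmodType R.

Lemma isomorphic_sym M N : isomorphic M N -> isomorphic N M.
Proof.
by move=> [h /linear_inverse[k [hK kK]]]; exists k; exists h.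
Qed.

Lemma sub_im_closed M N (h : {linear M -> N}) (x : submod M) :
  submod_closed [pred v : N | `[< exists2 u, u \in x & h u = v >]].
Proof.
split=> [|a v1 v2]; rewrite !inE; first by exists 0; rewrite ?rpred0 ?linear0.
move=> [u1 xu1 <-] [u2 xu2 <-].
by exists (a *: u1 + u2); rewrite ?linearP // rpredD ?rpredZ.
Qed.

(** The image of a submodule under a linear map. *)
Definition sub_im M N (h : {linear M -> N}) (x : submod M) : submod N :=
  Submod (sub_im_closed h x).

Lemma sub_imP M N (h : {linear M -> N}) (x : submod M) v :
  reflect (exists2 u, u \in x & h u = v) (v \in sub_im h x).
Proof. exact: asboolP. Qed.

Lemma full_closed M : submod_closed (fun _ : M => true).
Proof. by []. Qed.

(** The whole module, as a submodule of itself. *)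
Definition sub_full M : submod M := Submod (@full_closed M).

Lemma sub_im_iso M N (h : {linear M -> N}) (x : submod M) : injective h ->
  exists k : {linear submodule x -> submodule (sub_im h x)},
    bijective k /\ forall u, val (k u) = h (val u).
Proof.
move=> hI; have kP (u : submodule x) : h (val u) \in sub_im h x.
  by apply/sub_imP; exists (val u) => //; apply: valP.
have kl : linear (fun u : submodule x => SubCarrier (kP u) : submodule _).
  by move=> a u v; apply: val_inj; rewrite /= linearP.
exists (linear_of kl); split=> //; apply: inj_surj_bijective.
  by move=> u v /(congr1 val) /= /hI/val_inj.
move=> v; have /sub_imP[u xu uv] := valP v; exists (SubCarrier xu).
exact: val_inj.
Qed.

Lemma sub_im_tau M N (h : {linear M -> N}) (x : submod M) : injective h ->
  tau (submodule (sub_im h x)) = tau (submodule x).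
Proof.
move=> hI; apply/tau_eqP/isomorphic_sym.
by have [k [bk _]] := sub_im_iso x hI; exists k.
Qed.

Lemma sub_full_tau M : tau (submodule (sub_full M)) = tau M.
Proof.
have vl : linear (val : submodule (sub_full M) -> M) by move=> a u v.
apply/tau_eqP; exists (linear_of vl); apply: inj_surj_bijective.
  exact: val_inj.
have tt u : u \in sub_full M by [].
by move=> u; exists (SubCarrier (tt u)).
Qed.

(** The inclusion of a submodule, as a linear map. *)
Definition val_linear M (x : submod M) : {linear submodule x -> M} :=
  linear_of (fun a u v => erefl : val (a *: u + v : submodule x) = a *: val u + val v).

Lemma le_typeP M l : le_type l (tau M) <-> exists x : submod M, tau (submodule x) = l.
Proof.
split=> [[N [x [/tau_eqP[h bh] <-]]]|[x <-]]; last by exists M, x.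
by exists (sub_im h x); rewrite sub_im_tau //; apply: bij_inj.
Qed.

Lemma rel_closed M (f x : submod M) :
  submod_closed [pred u : submodule f | val u \in x].
Proof.
split=> [|a u v]; rewrite !inE /= ?rpred0 // => xu xv.
by rewrite rpredD ?rpredZ.
Qed.

(** The submodule of [submodule f] formed by the elements of [x]. *)
Definition rel_sub M (f x : submod M) : submod (submodule f) :=
  Submod (rel_closed f x).

Lemma rel_sub_iso M (f x : submod M) : {subset x <= f} ->
  exists k : {linear submodule (rel_sub f x) -> submodule x},
    bijective k /\ forall u, val (k u) = val (val u).
Proof.
move=> xf; have kl : linear (fun u : submodule (rel_sub f x) =>
    SubCarrier (valP u : val (val u) \in x) : submodule x).
  by move=> a u v; apply: val_inj.
exists (linear_of kl); split=> //; apply: inj_surj_bijective.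
  by move=> u v /(congr1 val) /= uv; do 2!apply: val_inj.
move=> v; have vf : (SubCarrier (xf _ (valP v)) : submodule f) \in rel_sub f x := valP v.
by exists (SubCarrier vf); apply: val_inj.
Qed.

Lemma le_type_sub M (x f : submod M) : {subset x <= f} ->
  le_type (tau (submodule x)) (tau (submodule f)).
Proof.
move=> /rel_sub_iso[k [bk _]]; apply/le_typeP; exists (rel_sub f x).
by apply/tau_eqP; exists k.
Qed.

Lemma aut_imP M (g : aut M) (x : submod M) v :
  reflect (exists2 u, u \in x & aut_fun g u = v) (v \in aut_im g x).
Proof. exact: asboolP. Qed.

Lemma aut_inj M (g : aut M) : injective (aut_fun g).
Proof. exact/bij_inj/aut_bij. Qed.

Lemma mem_aut_im M (g : aut M) (x : submod M) u :
  (aut_fun g u \in aut_im g x) = (u \in x).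
Proof.
by apply/aut_imP/idP => [[v xv /aut_inj <-] //|xu]; exists u.
Qed.

Lemma aut_im_incl M (g : aut M) (x y : submod M) :
  {subset aut_im g x <= aut_im g y} <-> {subset x <= y}.
Proof.
split=> xy v; first by rewrite -(mem_aut_im g) => /xy; rewrite mem_aut_im.
by move=> /aut_imP[u /xy yu <-]; rewrite mem_aut_im.
Qed.

Lemma aut_im_restrict M (g : aut M) (x y : submod M) : aut_im g x = y ->
  exists h : {linear submodule x -> submodule y},
    bijective h /\ forall u, val (h u) = aut_fun g (val u).
Proof.
move=> <-; have hP (u : submodule x) : aut_fun g (val u) \in aut_im g x.
  by rewrite mem_aut_im; apply: valP.
have hl : linear (fun u : submodule x => SubCarrier (hP u) : submodule (aut_im g x)).
  by move=> a u v; apply: val_inj; rewrite /= aut_linear.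
exists (linear_of hl); split=> //; apply: inj_surj_bijective.
  by move=> u v /(congr1 val) /= /aut_inj/val_inj.
move=> v; have /aut_imP[u xu uv] := valP v.
by exists (SubCarrier xu); apply: val_inj.
Qed.

(** On [x + w], the map [v + w1 |-> v + g w1] for [v] in [x] and [w1] in [w] is well
    defined because [g] is the identity on the intersection of [w] and [x]; it is
    injective because [x] meets the image of [w] in the same submodule. *)
Lemma glue_iso M (x w : submod M) (g : aut M) :
  {in submodI w x, forall v, aut_fun g v = v} ->
  submodI (aut_im g w) x = submodI w x ->
  exists h : {linear submodule (submodD x w) -> submodule (submodD x (aut_im g w))},
    bijective h /\ forall u v, v \in x -> val u - v \in w ->
      val (h u) = v + aut_fun g (val u - v).
Proof.
move=> gfix gwx.
have dec (u : submodule (submodD x w)) : exists v, v \in x /\ val u - v \in w.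
  have /asboolP[v [w1 [xv ww ->]]] := valP u.
  by exists v; rewrite addrC addKr.
(* [c u] is a chosen component of [u] in [x] *)
pose c u := projT1 (cid (dec u)).
have cP u : c u \in x /\ val u - c u \in w by rewrite /c; case: cid.
have hP u : c u + aut_fun g (val u - c u) \in submodD x (aut_im g w).
  apply/asboolP; exists (c u), (aut_fun g (val u - c u)).
  by have [cx cw] := cP u; rewrite mem_aut_im.
pose h u : submodule (submodD x (aut_im g w)) := SubCarrier (hP u).
have hE u v : v \in x -> val u - v \in w -> val (h u) = v + aut_fun g (val u - v).
  move=> xv wv; have [cx cw] := cP u; rewrite /=.
  have : v - c u \in submodI w x.
    apply/andP; split; last exact: rpredB.
    have -> : v - c u = (val u - c u) - (val u - v) by rewrite opprB [RHS]addrC subrKA.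
    exact: rpredB.
  move=> /gfix vc.
  have -> : aut_fun g (val u - c u) = aut_fun g (val u - v) + (v - c u).
    by rewrite -{1}vc -linearD subrKA.
  by rewrite addrCA [c u + _]addrC subrK addrC.
have hl : linear h.
  move=> a u v; apply: val_inj; have [ux uw] := cP u; have [vx vw] := cP v.
  have E : val (a *: u + v) - (a *: c u + c v) = a *: (val u - c u) + (val v - c v).
    by rewrite linearP opprD addrACA -scalerBr.
  have Ex : a *: c u + c v \in x by rewrite rpredD ?rpredZ.
  have Ew : a *: (val u - c u) + (val v - c v) \in w.
    by apply: rpredD => //; apply: rpredZ.
  by rewrite (hE (a *: u + v) _ Ex) E // aut_linear /= scalerDr addrACA.
exists (linear_of hl); split=> //; apply: inj_surj_bijective.
  apply: (raddf_inj (f := linear_of hl)) => u /(congr1 val) /=.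
  have [ux uw] := cP u => e0.
  have gu : aut_fun g (val u - c u) = - c u.
    by apply/eqP; rewrite -addr_eq0 addrC e0.
  have : aut_fun g (val u - c u) \in submodI w x.
    rewrite -gwx; apply/andP; split; first by rewrite mem_aut_im.
    by rewrite gu rpredN.
  move=> /gfix/aut_inj; rewrite gu => /eqP; rewrite eq_sym subr_eq addNr => /eqP u0.
  exact: val_inj.
move=> v; have /asboolP[v1 [w1 [xv /aut_imP[w2 ww2 <-] vE]]] := valP v.
have uP : v1 + w2 \in submodD x w by apply/asboolP; exists v1, w2.
have e : v1 + w2 - v1 = w2 by rewrite addrC addKr.
by exists (SubCarrier uP); apply: val_inj; rewrite [LHS](hE _ v1) //= e.
Qed.

Lemma aut_of_bijective M (k : {linear M -> M}) : bijective k ->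
  exists g : aut M, aut_fun g =1 k.
Proof.
move=> bk; have kP : is_aut k by apply/asboolP; split=> // a u v; rewrite linearP.
by exists (Aut kP).
Qed.

Section Symmetric.
Variables (F : lmodType R) (phi : mtype R).
Hypothesis symF : symmetric_type (tau F).
Hypothesis symphi : symmetric_type phi.
Implicit Types x y f k : submod F.

(** The symmetry of [tau F], for submodules of [F]. *)
Lemma extend_iso x y (h : {linear submodule x -> submodule y}) : bijective h ->
  exists g : aut F,
    (forall u, aut_fun g (val u) = val (h u)) /\ aut_im g x = y.
Proof.
move=> bh; have [k [bk kh]] := symF erefl erefl bh.
have [g gk] := aut_of_bijective bk.
have gh u : aut_fun g (val u) = val (h u) by rewrite gk kh.
exists g; split=> //; apply/submod_eqP => v; apply/aut_imP/idP => [[u xu <-]|yv].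
  by rewrite (gh (SubCarrier xu)); apply: valP.
have [h' hK h'K] := bh; exists (val (h' (SubCarrier yv))); first exact: valP.
by rewrite gh h'K.
Qed.

Lemma tau_aut x y : tau (submodule x) = tau (submodule y) <->
  exists g, aut_im g x = y.
Proof.
split=> [/tau_eqP[h bh]|[g <-]]; last by rewrite tau_aut_im.
by have [g [_ gx]] := extend_iso bh; exists g.
Qed.

Lemma glue_aut x w (g : aut F) :
  {in submodI w x, forall v, aut_fun g v = v} ->
  submodI (aut_im g w) x = submodI w x ->
  exists h : aut F, aut_im h x = x /\ aut_im h w = aut_im g w.
Proof.
move=> gfix gwx; have [h [bh hE]] := glue_iso gfix gwx.
have [k [kh _]] := extend_iso bh.
have kx v : v \in x -> aut_fun k v = v.
  move=> xv; have := kh (SubCarrier (submodDl w xv)).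
  by rewrite (hE _ v) //= subrr ?rpred0 // linear0 addr0.
have kw v : v \in w -> aut_fun k v = aut_fun g v.
  move=> wv; have := kh (SubCarrier (submodDr x wv)).
  by rewrite (hE _ 0) ?rpred0 //= subr0 // add0r.
exists k; split; apply/submod_eqP => v.
  apply/aut_imP/idP => [[u xu <-]|xv]; first by rewrite kx.
  by exists v; rewrite ?kx.
by apply/aut_imP/aut_imP => -[u wu <-]; exists u; rewrite ?kw.
Qed.

(** The symmetry of [phi], for submodules [f1], [f2] of [F] of type [phi]; the
    resulting isomorphism from [f1] to [f2] is extended to [F]. *)
Lemma extend_iso_sub f1 f2 k1 k2 (h : {linear submodule k1 -> submodule k2}) :
  tau (submodule f1) = phi -> tau (submodule f2) = phi ->
  {subset k1 <= f1} -> {subset k2 <= f2} -> bijective h ->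
  exists g : aut F,
    aut_im g f1 = f2 /\ forall u, aut_fun g (val u) = val (h u).
Proof.
move=> t1 t2 s1 s2 bh.
have [a [ba aE]] := rel_sub_iso s1; have [b [bb bE]] := rel_sub_iso s2.
have [b' [bK b'K]] := linear_inverse bb.
have [|K [bK' KE]] := symphi t1 t2 (h := b' \o (h \o a)).
  by apply: bij_comp; [exists b|apply: bij_comp].
have [g [gE gf]] := extend_iso bK'.
exists g; split=> // u; have [a' aK a'K] := ba.
rewrite -{1}(a'K u) aE gE KE /= -bE b'K a'K //.
Qed.

Lemma homog_sub f1 f2 k : tau (submodule f1) = phi -> tau (submodule f2) = phi ->
  {subset k <= f1} -> {subset k <= f2} ->
  exists2 g : aut F, {in k, forall v, aut_fun g v = v} & aut_im g f1 = f2.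
Proof.
move=> t1 t2 s1 s2; have bid : bijective (idfun : {linear submodule k -> submodule k}).
  by exists id.
have [g [gf gk]] := extend_iso_sub t1 t2 s1 s2 bid.
by exists g => // v kv; exact: (gk (SubCarrier kv)).
Qed.

(** The first property of a symmetric couple. *)
Hypothesis meetF : forall f, tau (submodule f) = phi -> forall l, le_type l phi ->
  exists f', tau (submodule f') = phi /\ tau (submodule (submodI f f')) = l.

(** The couple gives [f'] meeting [f] in a submodule of the type of [k]; the symmetry
    of [phi] moves this submodule to [k] within [f], and then [f] to the moved [f']
    while [k] is fixed. *)
Lemma meet_all_sub f x k : tau (submodule f) = phi ->
  {subset x <= f} -> {subset k <= x} ->
  exists2 g : aut F, {in k, forall v, aut_fun g v = v}
    & submodI (aut_im g f) x = k.
Proof.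
move=> tf xf kx; have kf : {subset k <= f} by move=> v /kx/xf.
have lk : le_type (tau (submodule k)) phi by rewrite -tf; apply: le_type_sub.
have [f' [tf' /tau_eqP[h bh]]] := meetF tf lk.
have [g [gf gE]] := extend_iso_sub tf tf (@submodIl _ _ f f') kf bh.
(* [f2] meets [f] in [k] *)
pose f2 := aut_im g f'.
have gmem u : (aut_fun g u \in f) = (u \in f) by rewrite -{1}gf mem_aut_im.
have f2k v : (v \in f) && (v \in f2) = (v \in k).
  apply/andP/idP => [[]|kv].
    rewrite -{1}gf => /aut_imP[u fu <-]; rewrite mem_aut_im => f'u.
    have uI : u \in submodI f f' by apply/andP.
    by rewrite (gE (SubCarrier uI)); apply: valP.
  have [h' hK h'K] := bh; have := gE (h' (SubCarrier kv)); rewrite h'K /= => <-.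
  have /andP[fu f'u] := valP (h' (SubCarrier kv)).
  by rewrite gmem mem_aut_im.
have kf2 : {subset k <= f2} by move=> v; rewrite -f2k => /andP[].
have [b bk bf] := homog_sub tf (etrans (tau_aut_im g f') tf') kf kf2.
exists b => //; apply/submod_eqP => v; rewrite bf.
apply/andP/idP => [[vf2 vx]|kv]; first by rewrite -f2k xf.
by rewrite kf2 ?kx.
Qed.

End Symmetric.
End SubmoduleTools.

Lemma finite_index (T : Type) : finite_set (@setT T) ->
  exists (N : nat) (b : 'I_N -> T) (b' : T -> 'I_N), cancel b b' /\ cancel b' b.
Proof.
move=> [N /card_set_bijP[f [fN fI fS]]]; exists N.
have fN' x : (f x < N)%N by apply: fN.
pose b' x := Ordinal (fN' x).
have b'I : injective b'.
  by move=> x y /(congr1 val) /= fxy; apply: fI => //; rewrite inE.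
have [b b'K bK] : bijective b'.
  apply: inj_surj_bijective => // i; have [x _ fx] := fS i (ltn_ord i).
  by exists x; apply: val_inj.
by exists b, b'.
Qed.

(** * Classes of embeddings *)
Section EmbeddingClasses.
Variables (R : pzRingType) (l n : mtype R).
Implicit Types e : embedding l n.

Lemma emb_equiv_refl e : emb_equiv e e.
Proof. by exists idfun, idfun; split=> //; exists id. Qed.

Lemma emb_equiv_sym e e' : emb_equiv e e' -> emb_equiv e' e.
Proof.
move=> [a [b [/linear_inverse[a' [aK a'K]] /linear_inverse[b' [bK b'K]] ab]]].
exists a', b'; split; [by exists a|by exists b|move=> u].
by apply: (can_inj bK); rewrite b'K ab a'K.
Qed.

Lemma emb_equiv_trans e1 e2 e3 :
  emb_equiv e1 e2 -> emb_equiv e2 e3 -> emb_equiv e1 e3.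
Proof.
move=> [a [b [ba bb ab]]] [c [d [bc bd cd]]].
exists (c \o a), (d \o b); split; [exact: bij_comp|exact: bij_comp|move=> u /=].
by rewrite ab cd.
Qed.

Lemma emb_equiv_eq e e' : emb_equiv e e' -> emb_equiv e = emb_equiv e'.
Proof.
move=> ee'; apply/funext => e2; apply/propext; split; last exact: emb_equiv_trans.
exact/emb_equiv_trans/emb_equiv_sym.
Qed.

(** The class of an embedding. *)
Definition emb_cls e : emb_class l n := exist _ (emb_equiv e) (ex_intro _ e erefl).

Lemma emb_cls_eq e e' : emb_cls e = emb_cls e' <-> emb_equiv e e'.
Proof.
split=> [[E]|ee']; first by rewrite E; exact: emb_equiv_refl.
by apply: eq_exist; apply: emb_equiv_eq.
Qed.

Lemma emb_cls_surj (c : emb_class l n) : exists e, c = emb_cls e.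
Proof. by case: c => C [e Ce]; exists e; apply: eq_exist. Qed.

End EmbeddingClasses.

Section InclusionEmbedding.
Variables (R : pzRingType) (F : lmodType R) (l n : mtype R).

Lemma incl_inj (y x : submod F) (s : {subset y <= x}) : injective (Defs.incl s).
Proof. by move=> u v /(congr1 val) /= /val_inj. Qed.

(** The inclusion of [y] in [x], as an embedding of type [l] in type [n]. *)
Definition incl_embedding (y x : submod F) (s : {subset y <= x})
    (ty : tau (submodule y) = l) (tx : tau (submodule x) = n) : embedding l n :=
  Embedding ty tx (@incl_inj _ _ s).

Hypothesis symF : symmetric_type (tau F).

(** Inclusions in [x] are equivalent exactly when they are conjugate under the
    stabilizer of [x], since automorphisms of [x] extend to [F]. *)
Lemma incl_embedding_equiv (y y' x : submod F) s ty s' ty' tx :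
  emb_equiv (@incl_embedding y x s ty tx) (@incl_embedding y' x s' ty' tx) <->
  exists g : aut F, aut_im g x = x /\ aut_im g y = y'.
Proof.
split=> [[a [b /= [ba bb ab]]]|[g [gx gy]]].
  have [g [gb gx]] := extend_iso symF bb; exists g; split=> //.
  have gE v (yv : v \in y) : aut_fun g v = val (a (SubCarrier yv)).
    have /(congr1 val) /= <- := ab (SubCarrier yv).
    by rewrite -gb.
  apply/submod_eqP => v; apply/aut_imP/idP => [[u yu <-]|yv].
    by rewrite gE; apply: valP.
  have [a' aK a'K] := ba; exists (val (a' (SubCarrier yv))); first exact: valP.
  by rewrite (gE _ (valP _))
    (_ : SubCarrier _ = a' (SubCarrier yv)) ?a'K //; apply: val_inj.
have [a [ba aE]] := aut_im_restrict gy; have [b [bb bE]] := aut_im_restrict gx.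
by exists a, b; split=> // u; apply: val_inj; rewrite bE /= aE.
Qed.

Lemma incl_embedding_surj (x : submod F) (tx : tau (submodule x) = n)
    (e : embedding l n) :
  exists (y : submod F) s ty, emb_equiv e (@incl_embedding y x s ty tx).
Proof.
have /tau_eqP[b bb] : tau (emb_tgt e) = tau (submodule x) by rewrite emb_tgtP.
pose h : {linear emb_src e -> F} := val_linear x \o (b \o emb_map e).
have hI : injective h.
  by move=> u v /= /val_inj /(bij_inj bb); exact: emb_inj.
pose y := sub_im h (sub_full (emb_src e)).
have s : {subset y <= x} by move=> v /sub_imP[u _ <-]; exact: valP.
have ty : tau (submodule y) = l by rewrite sub_im_tau // sub_full_tau emb_srcP.
exists y, s, ty.
have hP u : h u \in y by apply/sub_imP; exists u.
have al : linear (fun u => SubCarrier (hP u) : submodule y).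
  by move=> c u v; apply: val_inj; rewrite /= !linearP.
exists (linear_of al), b; split=> [|//|u]; last exact: val_inj.
apply: inj_surj_bijective => [u v /(congr1 val) /hI //|v].
by have /sub_imP[u _ uv] := valP v; exists u; apply: val_inj.
Qed.

End InclusionEmbedding.

(** * The lattice of submodules of a module *)

(** The submodules are indexed by ['I_N] through the bijection [b]. *)
Section SubmoduleLattice.
Variables (R : pzRingType) (F : lmodType R) (phi : mtype R).
Hypothesis symF : symmetric_type (tau F).
Hypothesis symphi : symmetric_type phi.
Hypothesis meetF : forall f : submod F, tau (submodule f) = phi ->
  forall l, le_type l phi ->
  exists f' : submod F, tau (submodule f') = phi /\ tau (submodule (submodI f f')) = l.
Variables (N : nat) (b : 'I_N -> submod F) (b' : submod F -> 'I_N).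
Hypotheses (bK : cancel b b') (b'K : cancel b' b).
Variable f0 : submod F.
Hypothesis tf0 : tau (submodule f0) = phi.

Definition sub_act (g : aut F) i := b' (aut_im g (b i)).
Definition sub_le i j := `[< {subset b i <= b j} >].
Definition sub_meet i j := b' (submodI (b i) (b j)).
Definition sub_fixes (g : aut F) i := {in b i, forall v, aut_fun g v = v}.

Lemma aut_im1 (x : submod F) : aut_im 1%g x = x.
Proof.
apply/submod_eqP => v; apply/aut_imP/idP => [[u xu <-] //|xv].
by exists v.
Qed.

Lemma aut_imM g h (x : submod F) : aut_im (g * h)%g x = aut_im g (aut_im h x).
Proof.
apply/submod_eqP => v; apply/aut_imP/aut_imP => [[u xu <-]|[_ /aut_imP[u xu <-] <-]].
  by exists (aut_fun h u); rewrite ?mem_aut_im.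
by exists u.
Qed.

Lemma sub_act1 i : sub_act 1%g i = i.
Proof. by rewrite /sub_act aut_im1 bK. Qed.

Lemma sub_actM g h i : sub_act (g * h)%g i = sub_act g (sub_act h i).
Proof. by rewrite /sub_act b'K aut_imM. Qed.

Lemma sub_le_refl : reflexive sub_le.
Proof. by move=> i; apply/asboolP. Qed.

Lemma sub_le_trans : transitive sub_le.
Proof. by move=> j i m /asboolP ij /asboolP jm; apply/asboolP => v /ij/jm. Qed.

Lemma sub_le_anti : antisymmetric sub_le.
Proof.
move=> i j /andP[/asboolP ij /asboolP ji]; apply: (can_inj bK).
by apply/submod_eqP => v; apply/idP/idP => [/ij|/ji].
Qed.

Lemma sub_le_meet m i j : sub_le m (sub_meet i j) = sub_le m i && sub_le m j.
Proof.
rewrite {1}/sub_le /sub_meet b'K.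
apply/asboolP/andP => [mij|[/asboolP mi /asboolP mj] v mv].
  by split; apply/asboolP => v /mij/andP[].
by apply/andP; split; [exact: mi|exact: mj].
Qed.

Lemma sub_le_act g i j : sub_le (sub_act g i) (sub_act g j) = sub_le i j.
Proof. by apply/asboolP/asboolP; rewrite /sub_act !b'K => /aut_im_incl. Qed.

Lemma sub_fixes_act g k z : sub_fixes g k -> sub_le z k -> sub_act g z = z.
Proof.
move=> gk /asboolP zk; apply: (canLR bK); apply/submod_eqP => v.
apply/aut_imP/idP => [[u zu <-]|zv]; first by rewrite gk ?zk.
by exists v; rewrite ?gk ?zk.
Qed.

Lemma sub_fixesV g k : sub_fixes g k -> sub_fixes g^-1%g k.
Proof. by move=> gk v kv; rewrite -{1}(gk v kv) [LHS]aut_funK. Qed.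

Lemma sub_fixesM g h k : sub_fixes g k -> sub_fixes h k -> sub_fixes (g * h)%g k.
Proof. by move=> gk hk v kv; rewrite [LHS]/= hk // gk. Qed.

Lemma sub_fixes_le g k z : sub_fixes g k -> sub_le z k -> sub_fixes g z.
Proof. by move=> gk /asboolP zk v /zk/gk. Qed.

Lemma sub_glue g x w : sub_fixes g (sub_meet w x) ->
  sub_meet (sub_act g w) x = sub_meet w x ->
  exists h, sub_act h x = x /\ sub_act h w = sub_act g w.
Proof.
rewrite /sub_fixes /sub_meet /sub_act !b'K => gk /(can_inj b'K) gm.
by have [h [hx hw]] := glue_aut symF gk gm; exists h; rewrite hx hw bK.
Qed.

Lemma sub_homog k g h : sub_le k (sub_act g (b' f0)) -> sub_le k (sub_act h (b' f0)) ->
  exists2 c, sub_fixes c k & sub_act c (sub_act g (b' f0)) = sub_act h (b' f0).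
Proof.
rewrite /sub_act !b'K => /asboolP kg /asboolP kh; rewrite !b'K in kg kh.
have tf g' : tau (submodule (aut_im g' f0)) = phi by rewrite tau_aut_im.
have [c ck cE] := homog_sub symF symphi (tf g) (tf h) kg kh.
by exists c; rewrite ?cE.
Qed.

Lemma sub_meet_all k x g : sub_le k x -> sub_le x (sub_act g (b' f0)) ->
  exists2 a, sub_fixes a k & sub_meet (sub_act a (sub_act g (b' f0))) x = k.
Proof.
rewrite /sub_act /sub_meet !b'K => /asboolP kx /asboolP xf; rewrite b'K in xf.
have tf : tau (submodule (aut_im g f0)) = phi by rewrite tau_aut_im.
have [a ak aE] := meet_all_sub symF symphi meetF tf xf kx.
by exists a => //; rewrite !b'K aE bK.
Qed.

(** The submodules of [F], with those of type [phi] as top orbit. *)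
Definition submodule_lattice : couple_lattice (aut F) N :=
  CoupleLattice sub_act1 sub_actM sub_le_refl sub_le_trans sub_le_anti
    sub_le_meet sub_le_act sub_fixes_act sub_fixesV sub_fixesM sub_fixes_le
    sub_glue sub_homog sub_meet_all.

Local Notation L := submodule_lattice.
Local Notation rho := (perm_rho L).
Local Notation im_rep := (im_rep (perm_rho1 L) (perm_rhoM L)).

(** Orbits are types. *)
Lemma orb_tau i j : orb L i j <-> tau (submodule (b i)) = tau (submodule (b j)).
Proof.
rewrite tau_aut //; split=> [/orbP[g <-]|[g gi]].
  by exists g; rewrite /= /sub_act b'K.
by apply/orbP; exists g; rewrite /= /sub_act gi bK.
Qed.

(** Small orbits are the types below [phi]. *)
Lemma small_tau l : le_type l phi <-> exists2 i, small L i & tau (submodule (b i)) = l.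
Proof.
rewrite -tf0; split=> [/le_typeP[x <-]|[i /existsP[f /andP[/orbP[g gf] /asboolP fi]] <-]].
  have vI : injective (val_linear f0) by exact: val_inj.
  exists (b' (sub_im (val_linear f0) x)); last by rewrite b'K sub_im_tau.
  apply/existsP; exists (b' f0); rewrite orb_refl; apply/asboolP.
  by rewrite !b'K => v /sub_imP[u _ <-]; apply: valP.
have := le_type_sub fi.
by rewrite -gf /= /sub_act !b'K tau_aut_im.
Qed.

(** The functions on the submodules of type [n], extended by zero to all
    submodules. *)
Lemma fun_rep_orb_proj i n : tau (submodule (b i)) = n ->
  rep_iso (fun_rep F n) (im_rep (orb_proj_orthproj L i)).
Proof.
move=> ti; apply: rep_iso_sym.
pose h (v : submodule (fixS (orb_proj L i))) : fun_space F n :=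
  fun x => val v 0 (b' (projT1 x)).
have hl : linear (h : im_rep (orb_proj_orthproj L i) -> fun_rep F n).
  by move=> a u v; apply/funext => x; rewrite /h !mxE.
exists (linear_of hl); split=> [|g v].
  pose f2v (f : fun_space F n) : 'rV[rat]_N := \row_j
    if pselect (tau (submodule (b j)) = n) is left p then f (exist _ (b j) p) else 0.
  have f2vP f : f2v f \in fixS (orb_proj L i).
    apply/fixSP/rowP => j; rewrite mul_mx_diag !mxE.
    case: pselect => [p|_]; last by rewrite mul0r.
    by have /orb_tau -> := etrans ti (esym p); rewrite mulr1.
  exists (fun f => SubCarrier (f2vP f)) => [v|f] /=.
    apply: val_inj => /=; apply/rowP => j; rewrite mxE.
    case: pselect => [p|np]; first by rewrite /h /= bK.
    have /fixSP/rowP/(_ j) := valP v; rewrite mul_mx_diag !mxE.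
    case: (boolP (orb L i j)) => [/orb_tau|_]; last by rewrite mulr0 => <-.
    by rewrite ti => /esym.
  apply/funext => -[x xn]; rewrite /h /= mxE.
  case: pselect => [p|[]]; last by rewrite b'K.
  by congr f; apply: eq_exist; rewrite b'K.
apply/funext => -[x xn]; rewrite /= /h /fun_act /=.
set y := b' (aut_im _ x); rewrite (_ : b' x = lat_act L g y); last first.
  by rewrite /y /= /sub_act b'K -aut_imM mulgV aut_im1.
rewrite mxE (bigD1 y) //= mxE eqxx mulr1 big1 ?addr0 // => z zy.
by rewrite mxE (can_eq (actK L g)) (negPf zy) mulr0.
Qed.

(** The submodules of [b i] of type [l], up to the stabilizer of [b i], are the
    classes of embeddings. *)
Lemma emb_class_card i l n j : small L i -> tau (submodule (b i)) = n ->
  small L j -> tau (submodule (b j)) = l ->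
  has_card (emb_class l n) #|[set y in sreps L i | orb_pos L y == orb_pos L j]|.
Proof.
move=> si ti sj tj; set Y := [set y in _ | _].
have Yle y : y \in Y -> {subset b y <= b i}.
  by rewrite inE => /andP[/sreps_le/asboolP].
have Ytau y : y \in Y -> tau (submodule (b y)) = l.
  by rewrite inE eq_sym orb_pos_orb // -tj => /andP[_ /orb_tau].
pose E (m : 'I_#|Y|) : embedding l n :=
  incl_embedding (Yle _ (enum_valP m)) (Ytau _ (enum_valP m)) ti.
have simE y z : sim L i y z <->
    exists g : aut F, aut_im g (b i) = b i /\ aut_im g (b y) = b z.
  split=> [/simP|] [g [gi gy]].
    by exists g; rewrite -{2}gi -gy /= /sub_act !b'K.
  by apply/simP; exists g; rewrite /= /sub_act gi gy !bK.
exists (fun m => emb_cls (E m)); apply: inj_surj_bijective.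
  move=> m1 m2 /emb_cls_eq/(incl_embedding_equiv symF)/simE sim12.
  have Ys (m : 'I_#|Y|) : enum_val m \in sreps L i.
    by have := enum_valP m; rewrite inE => /andP[].
  by apply/esym/enum_val_inj/eqP; rewrite -(sreps_sim (Ys m1) (Ys m2)).
move=> c; have [e ->] := emb_cls_surj c.
have [y [s [ty eq_e]]] := incl_embedding_surj ti e.
pose z := srep L i (b' y).
have yi : sub_le (b' y) i by apply/asboolP; rewrite b'K.
have sz : sim L i (b' y) z by exact: sim_srep.
have zY : z \in Y.
  rewrite inE srep_sreps //= (sim_orb_pos sz) eq_sym orb_pos_orb //.
  by apply/orb_tau; rewrite b'K tj ty.
exists (enum_rank_in zY z); apply/emb_cls_eq/emb_equiv_sym.
apply: emb_equiv_trans eq_e _; apply/incl_embedding_equiv => //.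
by move/simE: sz; rewrite b'K enum_rankK_in.
Qed.

End SubmoduleLattice.

Local Close Scope ring_scope.

Theorem theorem3 (R : pzRingType) (F : lmodType R) (Phi phi : mtype R)
    (fgF : finitely_generated F) (tauF : tau F = Phi)
    (symPhi : symmetric_type Phi)
    (finF : finite_set (@setT (submod F)))
    (phi_le_Phi : le_type phi Phi)
    (couple : symmetric_couple Phi phi) :
  exists U : mtype R -> rep (aut F),
    (forall l, le_type l phi -> irreducible (U l)) /\
    (forall l m, le_type l phi -> le_type m phi ->
       rep_iso (U l) (U m) -> l = m) /\
    (exists (k : nat) (t : 'I_k -> mtype R),
       injective t /\
       (forall l, le_type l phi <-> exists i, t i = l) /\
       rep_iso (fun_rep F phi)
               (rep_bigsum [seq U (t i) | i <- enum 'I_k])) /\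
    (forall l n, le_type l phi -> le_type n phi ->
       exists m : nat,
         has_card (emb_class l n) m /\
         multiplicity (U l) (fun_rep F n) m) /\
    (forall l, le_type l phi -> multiplicity (U l) (fun_rep F l) 1) /\
    (forall l n, le_type l phi -> le_type n phi -> ~ le_type l n ->
       multiplicity (U l) (fun_rep F n) 0).
Proof.
subst Phi; have [_ symphi _ /(_ F erefl) cpl] := couple.
have meetF f (tf : tau (submodule f) = phi) := (cpl f tf).1.
have [N [b [b' [bK b'K]]]] := finite_index finF.
have /le_typeP[f0 tf0] := phi_le_Phi.
pose L := submodule_lattice symPhi symphi meetF bK b'K tf0.
pose k := size (orbits L).
pose r (i : 'I_k) := nth (b' f0) (orbits L) i.
have orb_pos_r i : orb_pos L (r i) = i by apply: orb_pos_nth (ltn_ord i).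
have small_r i : small L (r i) by rewrite -orb_pos_small orb_pos_r.
pose t i := tau (submodule (b (r i))).
have orbL := orb_tau symPhi symphi meetF bK b'K tf0.
have smallL := small_tau symPhi symphi meetF bK b'K tf0.
have t_orb_pos x i : small L x -> tau (submodule (b x)) = t i <-> orb_pos L x = i.
  move=> sx; rewrite -(orb_pos_r i); split=> [/orbL|/eqP]; last first.
    by rewrite orb_pos_orb // => /orbL.
  by move=> xr; apply/eqP; rewrite orb_pos_orb.
have t_inj : injective t.
  by move=> i j /t_orb_pos - /(_ (small_r i)); rewrite orb_pos_r => /val_inj.
have tP l : le_type l phi <-> exists i, t i = l.
  split=> [/smallL[x sx <-]|[i <-]].
    have ltx : (orb_pos L x < k)%N by rewrite orb_pos_small.
    by exists (Ordinal ltx); apply/esym/t_orb_pos.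
  by apply/smallL; exists (r i).
pose U l : rep (aut F) :=
  if pselect (exists i, t i = l) is left p then constituent L (projT1 (cid p))
  else rep_zero (aut F).
have UE i : U (t i) = constituent L i.
  rewrite /U; case: pselect => [p|[]]; last by exists i.
  by case: cid => j /= /t_inj ->.
have mult l n (ln : le_type l phi) (nn : le_type n phi) : exists i j,
    [/\ small L i, tau (submodule (b i)) = n, t j = l,
     has_card (emb_class l n) #|[set y in sreps L i | orb_pos L y == j]| &
     multiplicity (U l) (fun_rep F n) #|[set y in sreps L i | orb_pos L y == j]|].
  have /smallL[i si ti] := nn.
  have /tP[j tj] := ln; exists i, j; split=> //.
    by rewrite -(orb_pos_r j); apply: emb_class_card.
  rewrite -tj UE; apply: constituent_multiplicity => //.
  exact: fun_rep_orb_proj.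
exists U; split; first by move=> l /tP[i <-]; rewrite UE; apply: constituent_irreducible.
split.
  move=> _ _ /tP[i <-] /tP[j <-]; rewrite !UE => /constituent_inj ij.
  by congr t; apply: val_inj; apply: ij.
split.
  exists k, t; split=> //; split=> //.
  rewrite (eq_map UE); apply: constituent_sum; apply: fun_rep_orb_proj.
  by rewrite /= b'K.
split.
  move=> l n ln nn; have [i [j [_ _ _ card mu]]] := mult l n ln nn.
  by eexists; split; [exact: card|exact: mu].
split.
  move=> l ll; have [i [j [si ti tj _]]] := mult l l ll ll.
  have <- : orb_pos L i = j by apply/t_orb_pos; rewrite ?ti.
  by rewrite card_sreps_self.
move=> l n ln nn nle; have [i [j [si ti tj _]]] := mult l n ln nn.
rewrite eq_card0 // => y; rewrite !inE; apply/negP.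
move=> /andP[/andP[yi _] /eqP cy]; apply: nle.
have <- : tau (submodule (b y)) = l.
  by rewrite -tj; apply/t_orb_pos => //; exact: small_le yi si.
by rewrite -ti; apply: le_type_sub; apply/asboolP.
Qed.
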